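(* Let $G$ be a countable group, and let $\rho$ be a topological action of $G$ on a compact connected one-manifold $M$ with subexponential growth of orbits. Then there exists a $C^1$ action $\hat\rho$ of $G$ on $M$ (that is, an action by $C^1$ diffeomorphisms) that is a blow-up of $\rho$.
   Context: A compact connected one-manifold is a compact interval or the circle. A topological action of $G$ on $M$ is a homomorphism $\rho\colon G\to\mathrm{Homeo}(M)$. The action has subexponential growth of orbits if for every nonempty finite subset $S\subset G$ and every point $x\in M$, $\lim_{n\to\infty}|S^nx|^{1/n}=1$, where $S^nx=\{\rho(s_1\cdots s_n)(x): s_j\in S\}$ (no uniformity in $S$ or $x$ is required). For two homomorphisms $\hat\rho,\rho\colon G\to\mathrm{Homeo}(M)$, $\hat\rho$ is a blow-up of $\rho$ if there exists a continuous surjective map $h\colon M\to M$ such that $h^{-1}(J)$ is connected for every connected set $J\subseteq M$, and such that $h\circ\hat\rho(g)=\rho(g)\circ h$ for every $g\in G$. *)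

(* Defs.v *)
From HB Require Import structures.
From mathcomp Require Import all_boot all_order all_algebra.
From mathcomp Require Import finmap.
From mathcomp Require Import all_classical all_reals all_analysis.
Set Implicit Arguments.
Unset Strict Implicit.
Unset Printing Implicit Defensive.
Import Order.TTheory GRing.Theory Num.Theory numFieldNormedType.Exports.
Local Open Scope classical_set_scope.
Local Open Scope ring_scope.

Definition circle_set (R : realType) : set (R * R) :=
  [set z | z.1 ^+ 2 + z.2 ^+ 2 = 1].

Inductive one_manifold (R : realType) : Type :=
| Interval (a b : R) of a < b
| Circle.

(* [set_type A] carries the topology induced by the inclusion of [A]. *)
Definition points (R : realType) (M : one_manifold R) : topologicalType :=
  match M with
  | Interval a b _ => set_type `[a, b]
  | Circle => set_type (@circle_set R)
  end.

Coercion points : one_manifold >-> Topological.type.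

Definition homeomorphism (T : topologicalType) (f : T -> T) : Prop :=
  exists g : T -> T,
    [/\ cancel f g, cancel g f, continuous f & continuous g].

Definition topological_action (G : groupType) (T : topologicalType)
    (rho : G -> T -> T) : Prop :=
  (forall g, homeomorphism (rho g)) /\
  (forall g h, rho (g * h)%g = rho g \o rho h).

(* The set of all products s_1 * ... * s_n with every s_j in S. *)
Definition fset_exp (G : groupType) (S : {fset G}) (n : nat) : {fset G} :=
  iter n (fun A : {fset G} => [fset (s * t)%g | s in S, t in A]%fset)
    [fset 1%g]%fset.

Definition subexponential_orbits (R : realType) (G : groupType)
    (T : topologicalType) (rho : G -> T -> T) : Prop :=
  forall (S : {fset G}) (x : T), S != fset0 ->
    (#|` [fset rho g x | g in fset_exp S n]%fset |%:R : R) `^ n%:R^-1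
      @[n --> \oo] --> (1 : R).

Definition blow_up (G : Type) (T : topologicalType)
    (rho' rho : G -> T -> T) : Prop :=
  exists h : T -> T,
    [/\ continuous h,
        set_surj setT setT h,
        forall J : set T, connected J -> connected (h @^-1` J)
      & forall g, h \o rho' g = rho g \o h].

(* The punctured neighbourhoods [x^'] are taken inside the interval, so the
   derivative is one-sided at the endpoints. *)
Definition interval_C1 (R : realType) (a b : R)
    (f : set_type `[a, b] -> set_type `[a, b]) : Prop :=
  exists2 f' : set_type `[a, b] -> R, continuous f' &
    forall x : set_type `[a, b],
      (\val (f y) - \val (f x)) / (\val y - \val x) @[y --> x^'] --> f' x.

Lemma circle_point_subproof (R : realType) (t : R) :
  (cos t, sin t) \in @circle_set R.
Proof. by rewrite inE /circle_set /= cos2Dsin2. Qed.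

Definition circle_point (R : realType) (t : R) : set_type (@circle_set R) :=
  exist _ (cos t, sin t) (circle_point_subproof t).

(* The smooth structure of the circle is the one for which the universal
   covering [circle_point] is a local diffeomorphism: a self-map of the circle
   is C^1 when it has a C^1 lift to the line. *)
Definition circle_C1 (R : realType)
    (f : set_type (@circle_set R) -> set_type (@circle_set R)) : Prop :=
  exists F : R -> R,
    [/\ forall t, derivable F t 1,
        continuous (derive1 F)
      & forall t, f (circle_point t) = circle_point (F t)].

Definition C1 (R : realType) (M : one_manifold R) : (M -> M) -> Prop :=
  match M with
  | Interval a b _ => @interval_C1 R a b
  | Circle => @circle_C1 R
  end.

Definition C1_diffeomorphism (R : realType) (M : one_manifold R)
    (f : M -> M) : Prop :=
  exists g : M -> M, [/\ cancel f g, cancel g f, C1 f & C1 g].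

Definition C1_action (R : realType) (G : groupType) (M : one_manifold R)
    (rho : G -> M -> M) : Prop :=
  topological_action rho /\ (forall g, C1_diffeomorphism (rho g)).

(* Main.v *)
Require Import Defs.
From mathcomp Require Import all_boot all_order all_algebra.
From mathcomp Require Import finmap.
From mathcomp Require Import all_classical all_reals all_analysis.
From mathcomp Require Import ring lra.

(** The action is blown up at all the points of a countable dense invariant set,
    namely the orbits of the rational points of the manifold. A point [x] is
    replaced by a gap of length [w x], where the weights [w] have total mass 1
    and the gaps fill the new manifold up to a set of measure zero.

    Subexponential growth of the orbits allows weights that vary slowly: for
    every group element [g], the ratio of [w (g x)] to [w x] tends to 1 when [x]
    leaves every finite set ([weight_ratio]). For one finite set [S] of group
    elements and one base point, the weight [r ^+ n], where [n] is the least
    number of steps by which [x] is reached, is summable if [r < 1] since the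
    spheres grow subexponentially, and one step by [S] multiplies it at worst by
    [r]. The weight of a point is the supremum of countably many such weights,
    with larger and larger sets [S], more and more base points, ratios [r]
    tending to 1 and summable coefficients; away from a finite set only the
    slow ones matter.

    On the gaps, the group acts by the maps [gap_map] between segments. They
    compose, commute with the flips, have derivative 1 at the ends, and their
    derivatives lie between 1 and the square of the ratio of the lengths. The
    candidate derivative of a group element on the new manifold, namely the
    derivative of [gap_map] in the gaps and 1 elsewhere, up to the orientation,
    is thus continuous ([speed_continuous]). As the gaps have full measure in
    the source and in the target, the mean value inequality for the gaps adds up
    to a mean value inequality for the group element ([blow_mvt]), so this is
    indeed its derivative ([blow_diff]). The blow-up map collapses the gaps; its
    fibres are segments or points, whence connected preimages of connected sets
    ([connected_preimage]).

    The construction takes place on the line, for periodic weights and for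
    monotone bijections of the line that commute up to sign with the unit
    translation. On the circle, these are the lifts of homeomorphisms to the
    universal covering ([circle_lift]). Homeomorphisms of an interval extend
    periodically to such bijections ([seg_lift]); the endpoints get no weight
    and are not blown up. *)

Set Implicit Arguments.
Unset Strict Implicit.
Unset Printing Implicit Defensive.
Import Order.TTheory GRing.Theory Num.Theory numFieldNormedType.Exports.
Local Open Scope classical_set_scope.
Local Open Scope ring_scope.

(** * Preliminaries *)

Section integer_translations.
Variable R : realType.

Lemma equivariant_int (f : R -> R) (c : R) : (forall x, f (x + 1) = f x + c) ->
  forall x (n : int), f (x + n%:~R) = f x + c * n%:~R.
Proof.
move=> f1; have pos y (k : nat) : f (y + k%:R) = f y + c * k%:R.
  by elim: k => [|k IH]; rewrite ?mulr0 ?addr0// -natr1 addrA f1 IH; ring.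
move=> x n; case: (intP n) => [|k|k]; first by rewrite mulr0 !addr0.
  exact: pos.
have := pos (x - k.+1%:R) k.+1; rewrite subrK mulrNz => ->; ring.
Qed.

Lemma periodic_int (T : Type) (f : R -> T) : (forall x, f (x + 1) = f x) ->
  forall x (n : int), f (x + n%:~R) = f x.
Proof.
move=> f1; have pos y (k : nat) : f (y + k%:R) = f y.
  by elim: k => [|k IH]; rewrite ?addr0// -natr1 addrA f1.
move=> x n; case: (intP n) => [|k|k]; first by rewrite addr0.
  exact: pos.
by rewrite -(pos _ k.+1) mulrNz subrK.
Qed.

Lemma sign_mul_int (sg : R) (n : int) : sg = 1 \/ sg = -1 ->
  exists m : int, sg * n%:~R = m%:~R.
Proof.
case=> ->; first by exists n; rewrite mul1r.
by exists (- n)%R; rewrite mulN1r mulrNz.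
Qed.

End integer_translations.

Lemma int_near (m k : int) : k < m + 2 -> m - 2 < k ->
  (k = m - 1 \/ k = m \/ k = m + 1)%R.
Proof.
move=> km2 mk2; case: (ltgtP k m) => [km|mk|->]; last by right; left.
  left; apply/le_anti; rewrite lerBrDr lezD1 km lerBlDr -ltzD1 -addrA.
  by rewrite -ltrBlDr.
by right; right; apply/le_anti; rewrite lezD1 mk -ltzD1 -addrA andbT.
Qed.

(** * Maps between gaps *)

Section gap_map.
Variable R : realType.
Implicit Types a b c r : R.

(** The identification of a gap of half width [a] with a gap of half width [b],
    both centred at 0. In the coordinate [1 / (a - r) - 1 / a] of the half gap
    [r >= 0] it becomes the identity, so that these maps compose
    ([gap_mapK]); they are odd, hence commute with the flips of the gaps. *)
Definition gap_map a b r : R := b ^+ 2 * r / (a ^+ 2 + (b - a) * `|r|).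

(** The square root of the derivative of [gap_map a b]. *)
Definition gap_slope a b r : R := a * b / (a ^+ 2 + (b - a) * `|r|).

(** Two half widths are compatible when both are positive, or both vanish; in
    the second case the gap is a point and [gap_map] is 0 there. *)
Definition same_gap a b := (0 < a) && (0 < b) || (a == 0) && (b == 0).

Lemma gap_den_gt0 a b r : 0 < a -> 0 < b -> `|r| <= a ->
  0 < a ^+ 2 + (b - a) * `|r|.
Proof.
move=> a0 b0 ra; have -> : a ^+ 2 + (b - a) * `|r| = a * (a - `|r|) + b * `|r|.
  by ring.
have [->|r0] := eqVneq r 0; first by rewrite normr0 subr0 mulr0 addr0 mulr_gt0.
apply: ltr_wpDl; last by rewrite mulr_gt0// normr_gt0.
by rewrite mulr_ge0 ?subr_ge0// ltW.
Qed.

Lemma gap_map00 : gap_map 0 0 0 = 0.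
Proof. by rewrite /gap_map mulr0 mul0r. Qed.

Lemma gap_mapN a b r : gap_map a b (- r) = - gap_map a b r.
Proof. by rewrite /gap_map normrN mulrN mulNr. Qed.

Lemma gap_slopeN a b r : gap_slope a b (- r) = gap_slope a b r.
Proof. by rewrite /gap_slope normrN. Qed.

Lemma gap_map_id a r : `|r| <= a -> gap_map a a r = r.
Proof.
have [->|a0 _] := eqVneq a 0.
  by rewrite normr_le0 => /eqP ->; exact: gap_map00.
rewrite /gap_map subrr mul0r addr0 mulrAC divff ?mul1r//.
by rewrite expf_eq0.
Qed.

Lemma norm_gap_map a b r : 0 < a -> 0 < b -> `|r| <= a ->
  `|gap_map a b r| = b ^+ 2 * `|r| / (a ^+ 2 + (b - a) * `|r|).
Proof.
move=> a0 b0 ra; have d0 := gap_den_gt0 a0 b0 ra.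
rewrite /gap_map normf_div normrM (ger0_norm (ltW d0)) ger0_norm//.
exact: sqr_ge0.
Qed.

Lemma gap_map_le a b r : same_gap a b -> `|r| <= a -> `|gap_map a b r| <= b.
Proof.
case/orP=> /andP[] => [a0 b0 ra|/eqP -> /eqP ->]; last first.
  by rewrite normr_le0 => /eqP ->; rewrite gap_map00 normr0.
rewrite norm_gap_map// ler_pdivrMr ?gap_den_gt0//.
have : 0 <= b * (a * (a - `|r|)).
  by rewrite !mulr_ge0 ?subr_ge0// ltW.
lra.
Qed.

Lemma gap_mapK a b c r : same_gap a b -> same_gap b c -> `|r| <= a ->
  gap_map b c (gap_map a b r) = gap_map a c r.
Proof.
case/orP=> /andP[] => [a0 b0|/eqP -> /eqP ->]; last first.
  move=> /orP[/andP[]|/andP[_ /eqP ->]]; first by rewrite ltxx.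
  by rewrite normr_le0 => /eqP ->; rewrite !gap_map00.
case/orP=> /andP[] => [_ c0 ra|/eqP b00]; last by rewrite b00 ltxx in b0.
have d0 := gap_den_gt0 a0 b0 ra; have d1 := gap_den_gt0 a0 c0 ra.
rewrite {1}/gap_map norm_gap_map// /gap_map; set m := `|r| in ra d0 d1 *.
field; rewrite !lt0r_neq0//=.
have -> : b ^+ 2 * (a ^+ 2 + (b - a) * m) + (c - b) * (b ^+ 2 * m) =
  b ^+ 2 * (a ^+ 2 + (c - a) * m) by ring.
by rewrite mulr_gt0// exprn_gt0.
Qed.

Lemma gap_map_slope_ge0 a b r r' : 0 < a -> 0 < b -> 0 <= r -> r <= r' ->
  r' <= a -> gap_map a b r' - gap_map a b r =
             gap_slope a b r * gap_slope a b r' * (r' - r).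
Proof.
move=> a0 b0 r0 rr' r'a.
have r'0 : 0 <= r' by exact: le_trans rr'.
have d0 : 0 < a ^+ 2 + (b - a) * `|r|.
  by rewrite gap_den_gt0// ger0_norm// (le_trans rr').
have d1 : 0 < a ^+ 2 + (b - a) * `|r'| by rewrite gap_den_gt0// ger0_norm.
move: d0 d1; rewrite /gap_map /gap_slope !ger0_norm// => d0 d1.
by field; rewrite !lt0r_neq0.
Qed.

Lemma gap_slope_gt0 a b r : 0 < a -> 0 < b -> `|r| <= a -> 0 < gap_slope a b r.
Proof. by move=> a0 b0 ra; rewrite divr_gt0 ?mulr_gt0 ?gap_den_gt0. Qed.

(** Mean value inequality for [gap_map]: on a half gap, the slope of a chord is
    the geometric mean of the derivatives at its two ends
    ([gap_map_slope_ge0]). *)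
Lemma gap_map_mvt a b l u r r' : same_gap a b -> - a <= r -> r <= r' ->
  r' <= a -> (forall x, r <= x <= r' -> l <= gap_slope a b x ^+ 2 <= u) ->
  l * (r' - r) <= gap_map a b r' - gap_map a b r <= u * (r' - r).
Proof.
case/orP=> /andP[] => [a0 b0|/eqP -> /eqP ->]; last first.
  rewrite oppr0 => r0 rr' r'0 _.
  have -> : r = 0 by apply/eqP; rewrite eq_le r0 (le_trans rr').
  have -> : r' = 0 by apply/eqP; rewrite eq_le r'0 (le_trans r0).
  by rewrite !subrr !mulr0 lexx.
have pos (x y : R) : 0 <= x -> x <= y -> y <= a ->
    (forall z, x <= z <= y -> l <= gap_slope a b z ^+ 2 <= u) ->
    l * (y - x) <= gap_map a b y - gap_map a b x <= u * (y - x).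
  move=> x0 xy ya H; rewrite gap_map_slope_ge0//.
  have /andP[lx xu] := H x (introT andP (conj (lexx _) xy)).
  have /andP[ly yu] := H y (introT andP (conj xy (lexx _))).
  have sx : 0 < gap_slope a b x.
    by apply: gap_slope_gt0; rewrite ?ger0_norm// (le_trans xy).
  have sy : 0 < gap_slope a b y.
    by apply: gap_slope_gt0; rewrite ?ger0_norm// (le_trans x0).
  have yx : 0 <= y - x by rewrite subr_ge0.
  set p := gap_slope a b x in lx xu sx *; set q := gap_slope a b y in ly yu sy *.
  have [pq|qp] := leP p q.
    have : p ^+ 2 <= p * q <= q ^+ 2.
      by rewrite !expr2 (ler_wpM2l (ltW sx) pq) (ler_wpM2r (ltW sy) pq).
    by move=> /andP[? ?]; apply/andP; split; apply: ler_wpM2r => //; lra.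
  have : q ^+ 2 <= p * q <= p ^+ 2.
    by rewrite !expr2 (ler_wpM2r (ltW sy) (ltW qp)) (ler_wpM2l (ltW sx) (ltW qp)).
  by move=> /andP[? ?]; apply/andP; split; apply: ler_wpM2r => //; lra.
have neg (x y : R) : - a <= x -> x <= y -> y <= 0 ->
    (forall z, x <= z <= y -> l <= gap_slope a b z ^+ 2 <= u) ->
    l * (y - x) <= gap_map a b y - gap_map a b x <= u * (y - x).
  move=> ax xy y0 H.
  have -> : y - x = - x - - y by ring.
  have -> : gap_map a b y - gap_map a b x = gap_map a b (- x) - gap_map a b (- y).
    by rewrite !gap_mapN; ring.
  apply: pos; rewrite ?oppr_ge0 ?lerN2// 1?lerNl// => z zxy.
  by rewrite -gap_slopeN; apply: H; rewrite lerNr lerNl andbC.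
move=> ar rr' r'a H.
have [r0|r0] := leP 0 r; first exact: pos.
have [r'0|r'0] := leP r' 0; first exact: neg.
have /andP[N1 N2] : l * (0 - r) <= gap_map a b 0 - gap_map a b r <= u * (0 - r).
  apply: neg => //; first exact: ltW.
  by move=> z /andP[rz z0]; apply: H; rewrite rz (le_trans z0)// ltW.
have /andP[P1 P2] : l * (r' - 0) <= gap_map a b r' - gap_map a b 0 <= u * (r' - 0).
  apply: pos => //; first exact: ltW.
  by move=> z /andP[z0 zr']; apply: H; rewrite zr' andbT (le_trans _ z0)// ltW.
by apply/andP; split; lra.
Qed.

(** The derivative is 1 at both ends of the gap, whatever the half widths: this
    is what makes the maps of different gaps fit together. *)
Lemma gap_slope_bd a b r : 0 < a -> 0 < b -> `|r| = a -> gap_slope a b r = 1.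
Proof.
move=> a0 b0 ra; rewrite /gap_slope ra.
have -> : a ^+ 2 + (b - a) * a = a * b by ring.
by rewrite divff// mulf_neq0// lt0r_neq0.
Qed.

Lemma gap_slope_near1 a b r e : 0 < a -> 0 < b -> `|r| <= a ->
  0 <= e -> e <= 1 -> `|b - a| <= e * a -> `|gap_slope a b r ^+ 2 - 1| <= 3 * e.
Proof.
move=> a0 b0 ra e0 e1 ba; have d0 := gap_den_gt0 a0 b0 ra.
have s0 := gap_slope_gt0 a0 b0 ra.
have E : gap_slope a b r - 1 =
    (b - a) * (a - `|r|) / (a ^+ 2 + (b - a) * `|r|).
  by rewrite /gap_slope; field; rewrite lt0r_neq0.
set s := gap_slope a b r in s0 E *.
have r0 := normr_ge0 r.
have ar : 0 <= a - `|r| by rewrite subr_ge0.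
have br : 0 <= b * `|r| by rewrite mulr_ge0// ltW.
have eab : 0 <= e * (b * `|r|) by rewrite mulr_ge0.
move: ba; rewrite ler_norml => /andP[ba1 ba2].
have s1 : - e <= s - 1.
  rewrite E ler_pdivlMr//; have := ler_wpM2r ar ba1; lra.
have s2 : s - 1 <= e.
  rewrite E ler_pdivrMr//; have := ler_wpM2r ar ba2; lra.
by rewrite ler_norml; apply/andP; split; nra.
Qed.

End gap_map.

(** * Atomic measures on the line and blown-up points *)

Section esum_complements.
Variables (R : realType) (T : choiceType).
Implicit Types (f g : T -> R) (J : set T).

Lemma esum_le_scale J f g c : 0 <= c -> (forall x, J x -> 0 <= g x) ->
  (forall x, J x -> f x <= c * g x) ->
  (\esum_(x in J) (f x)%:E <= c%:E * \esum_(x in J) (g x)%:E)%E.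
Proof.
move=> c0 g0 fg; apply: ge_ereal_sup => _ [X [finX XJ] <-].
apply: (@le_trans _ _ (c%:E * \sum_(x \in X) (g x)%:E)%E).
  rewrite !fsbig_finite//= !sumEFin -EFinM lee_fin mulr_sumr big_seq [leRHS]big_seq.
  by apply: ler_sum => x; rewrite in_fset_set// inE => /XJ/fg.
by apply: lee_wpmul2l; rewrite ?lee_fin//; apply: esum_ge; exists X.
Qed.

(** A finite part of a convergent sum of nonnegative terms carries all of it up
    to any prescribed error. *)
Lemma esum_tail J f e : (forall x, J x -> 0 <= f x) ->
  \esum_(x in J) (f x)%:E \is a fin_num -> 0 < e ->
  exists X : set T, [/\ finite_set X, X `<=` J &
    (\esum_(x in J `&` ~` X) (f x)%:E < e%:E)%E].
Proof.
move=> f0 fin e0.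
have [_ [X [finX XJ] <-] lt] := ub_ereal_sup_adherent e0 fin.
exists X; split => //; move: lt fin; rewrite -/(\esum_(x in J) (f x)%:E).
have E := @esumID R T X J (fun x => (f x)%:E) (fun x Jx => f0 x Jx).
rewrite (_ : J `&` X = X) in E; last by apply/setIidPr.
rewrite (esum_fset finX) in E; last by move=> x /[!inE] /XJ/f0.
rewrite E fsbig_finite//= sumEFin.
case: (\esum_(x in J `&` ~` X) (f x)%:E)%E => [r| |] //=.
by rewrite -!EFinD !lte_fin => H _; lra.
Qed.

End esum_complements.

Section atomic_line.
Variables (R : realType) (w : R -> R).
Implicit Types x y z t : R.

(** The mass of [J] for the purely atomic measure with an atom of mass [w x] at
    every [x]. *)
Definition mass (J : set R) : \bar R := \esum_(x in J) (w x)%:E.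

Hypothesis w_ge0 : forall x, 0 <= w x.
Hypothesis w_periodic : forall x, w (x + 1) = w x.
Hypothesis w_mass : mass `[0, 1[ = 1%E.
Hypothesis w_dense : forall x y, x < y -> exists2 z, x < z < y & 0 < w z.

Lemma w_periodicz x (n : int) : w (x + n%:~R) = w x.
Proof. exact: (periodic_int w_periodic). Qed.

Lemma mass_ge0 J : (0 <= mass J)%E.
Proof. by apply: esum_ge0 => x _; rewrite lee_fin. Qed.

Lemma mass_split J K : mass J = (mass (J `&` K) + mass (J `&` ~` K))%E.
Proof. by rewrite /mass (esumID K)// => x _; rewrite lee_fin. Qed.

Lemma mass_sub J K : J `<=` K -> (mass J <= mass K)%E.
Proof.
move=> JK; rewrite [leRHS](mass_split K J) (_ : K `&` J = J); last exact/setIidPr.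
by rewrite leeDl// mass_ge0.
Qed.

Lemma mass_set1 x : mass [set x] = (w x)%:E.
Proof. by rewrite /mass esum_set1// lee_fin. Qed.

Lemma mass_cat x y z : x <= y -> y <= z ->
  mass `[x, z[ = (mass `[x, y[ + mass `[y, z[)%E.
Proof.
move=> xy yz; rewrite (mass_split _ `[x, y[); congr (mass _ + mass _)%E.
  apply/seteqP; split => [t [] //|t /= txy]; split => //=.
  move: txy; rewrite !in_itv/= => /andP[-> ty].
  by rewrite (lt_le_trans ty).
apply/seteqP; split => [t /= []|t /=]; rewrite !in_itv/=.
  by move=> /andP[-> ->] /negP; rewrite /= -leNgt andbT.
move=> /andP[yt tz]; rewrite tz (le_trans xy)//; split => //.
by rewrite ltNge yt.
Qed.

Lemma mass_lopen x y : x < y -> mass `[x, y[ = ((w x)%:E + mass `]x, y[)%E.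
Proof.
move=> xy; rewrite (mass_split _ [set x]) -mass_set1; congr (mass _ + mass _)%E.
  by apply/seteqP; split => [t [] //|t /= ->]; rewrite in_itv/= lexx xy.
apply/seteqP; split => [t /= []|t /=]; rewrite !in_itv/=.
  by move=> /andP[xt ->] /eqP tx; rewrite lt_neqAle eq_sym tx xt.
move=> /andP[xt ->]; rewrite ltW//; split => //.
by apply/eqP; rewrite gt_eqF.
Qed.

Lemma mass_shift x y (n : int) : mass `[x + n%:~R, y + n%:~R[ = mass `[x, y[.
Proof.
rewrite /mass (@reindex_esum R _ _ `[x, y[%classic _ (fun t => t + n%:~R)).
  by apply: eq_esum => t _; rewrite w_periodicz.
split => [t /=|t u _ _ /addIr//|t /=]; rewrite !in_itv/=.
  by rewrite lerD2r ltrD2r.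
move=> tn; exists (t - n%:~R); rewrite ?subrK//= in_itv/=.
by rewrite lerBrDr ltrBlDr.
Qed.

Lemma mass_unit x : mass `[x, x + 1[ = 1%E.
Proof.
pose n := Num.floor x; pose r := x - n%:~R.
have r0 : 0 <= r by rewrite subr_ge0 floor_le_tmp.
have r1 : r < 1 by rewrite ltrBlDl -intrD1 lt_succ_floor.
have -> : x + 1 = r + 1 + n%:~R by rewrite /r; ring.
have -> : x = r + n%:~R by rewrite subrK.
rewrite mass_shift.
rewrite (@mass_cat r 1 (r + 1)) ?lerDr//; last exact: ltW.
have -> : `[1, r + 1[%classic = `[0 + 1%:~R, r + 1%:~R[%classic :> set R.
  by rewrite add0r.
by rewrite mass_shift addeC -mass_cat// ltW.
Qed.

Lemma mass_fin x y : mass `[x, y[ \is a fin_num.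
Proof.
have H (n : nat) : mass `[x, x + n%:R[ = n%:R%:E.
  elim: n => [|n IH]; first by rewrite addr0 /mass set_itvco0 esum_set0.
  rewrite (@mass_cat x (x + n%:R)) ?lerDl// ?lerD2l ?ler_nat// IH.
  by rewrite -natr1 addrA mass_unit EFinD.
rewrite ge0_fin_numE ?mass_ge0//.
have [n yn] : exists n : nat, y <= x + n%:R.
  exists (Num.trunc (`|y - x|)).+1; rewrite -lerBlDl.
  by rewrite (le_trans (ler_norm _))// ltW// truncnS_gt.
apply: (@le_lt_trans _ _ (mass `[x, x + n%:R[)); last by rewrite H ltry.
apply: mass_sub => t /=; rewrite !in_itv/= => /andP[-> ty].
by rewrite (lt_le_trans ty).
Qed.

Lemma mass_oo_fin x y : mass `]x, y[ \is a fin_num.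
Proof.
rewrite ge0_fin_numE ?mass_ge0//.
apply: (@le_lt_trans _ _ (mass `[x, y[)); last by rewrite ltey_eq mass_fin.
by apply: mass_sub => t /=; rewrite !in_itv/= => /andP[/ltW -> ->].
Qed.

(** The distribution function of the measure, normalized to vanish at 0. *)
Definition cumul x : R :=
  if 0 <= x then fine (mass `[0, x[) else - fine (mass `[x, 0[).

Lemma cumulB x y : x <= y -> cumul y - cumul x = fine (mass `[x, y[).
Proof.
have E a b c : a <= b -> b <= c ->
    fine (mass `[a, c[) = fine (mass `[a, b[) + fine (mass `[b, c[).
  by move=> ab bc; rewrite (mass_cat ab bc) fineD ?mass_fin.
rewrite /cumul => xy; have [x0|x0] := leP 0 x.
  by rewrite (le_trans x0 xy) (E 0 x y)// addrAC subrr add0r.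
have [y0|y0] := leP 0 y.
  by rewrite opprK addrC -E// ltW.
by rewrite (E x y 0)// ?ltW//; ring.
Qed.

(** Half the width of the gap that replaces [x]. *)
Definition half x := w x / 2.

(** Midpoint of the gap that replaces [x], normalized so that [center 0 = 0]. *)
Definition center x := cumul x + half x - half 0.

Lemma half_ge0 x : 0 <= half x. Proof. by rewrite divr_ge0. Qed.

Lemma half_periodicz x (n : int) : half (x + n%:~R) = half x.
Proof. by rewrite /half w_periodicz. Qed.

Lemma center0 : center 0 = 0.
Proof. by rewrite /center /cumul lexx /mass set_itvco0 esum_set0 add0r subrr. Qed.

Lemma centerB x y : x < y ->
  center y - center x = half x + half y + fine (mass `]x, y[).
Proof.
move=> xy; have := cumulB (ltW xy).
rewrite (mass_lopen xy) fineD ?mass_oo_fin//= /center /half; lra.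
Qed.

Lemma centerD1 x : center (x + 1) = center x + 1.
Proof.
have := @cumulB x (x + 1); rewrite lerDl ler01 mass_unit /= => /(_ isT).
have := half_periodicz x 1; rewrite /center => ->; lra.
Qed.

Lemma centerDz x (n : int) : center (x + n%:~R) = center x + n%:~R.
Proof. by rewrite (equivariant_int centerD1) mul1r. Qed.

Lemma mass_oo_gt0 x y : x < y -> 0 < fine (mass `]x, y[).
Proof.
move=> /w_dense[z zxy wz]; rewrite fine_gt0// -ge0_fin_numE ?mass_ge0//.
rewrite mass_oo_fin andbT (@lt_le_trans _ _ (w z)%:E) ?lte_fin//.
by rewrite -mass_set1; apply: mass_sub => t /= ->; rewrite in_itv.
Qed.

Lemma gaps_disjoint x y : x < y -> center x + half x < center y - half y.
Proof. by move=> xy; have := centerB xy; have := mass_oo_gt0 xy; lra. Qed.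

(** Small punctured neighbourhoods have small mass. *)
Lemma mass_ball x (e : R) : 0 < e ->
  exists2 d : R, 0 < d & (mass (`](x - d)%R, (x + d)%R[ `\ x) < e%:E)%E.
Proof.
move=> e0; have fin : mass `]x - 1, x + 1[ \is a fin_num by exact: mass_oo_fin.
have [X [finX _ tail]] := esum_tail (fun t _ => w_ge0 t) fin e0.
have [d /= d0 dX] : exists2 d, 0 < d & ball x d `<=` ~` (X `\ x).
  have : nbhs x (~` (X `\ x)).
    apply: open_nbhs_nbhs; split; last by case=> _; apply.
    rewrite openC.
    have /accessible_finite_set_closed := hausdorff_accessible (@Rhausdorff R).
    by apply; exact: finite_setD.
  by move=> /nbhs_ballP[d ? ?]; exists d.
pose m := Num.min d 1.
have md : m <= d by rewrite ge_min lexx.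
have m1 : m <= 1 by rewrite ge_min lexx orbT.
exists m => [|]; first by rewrite lt_min d0 ltr01.
apply: le_lt_trans tail; apply: mass_sub => t [/=].
rewrite !in_itv/= => /andP[t1 t2] tx; split.
  by apply/andP; split; lra.
move=> Xt; apply: (dX t); last by split.
by rewrite /ball/= ltr_norml; apply/andP; split; lra.
Qed.

(** The gap that replaces [x], a point when [x] is not an atom, is the segment
    of the [t] with [in_gap x t]. *)
Definition in_gap x t := `|t - center x| <= half x.

Lemma in_gapP x t :
  reflect (center x - half x <= t /\ t <= center x + half x) (in_gap x t).
Proof.
rewrite /in_gap ler_norml.
by apply: (iffP andP) => -[? ?]; split; lra.
Qed.

Lemma gap_center x : in_gap x (center x).
Proof. by rewrite /in_gap subrr normr0 half_ge0. Qed.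

Lemma gap_uniq x y t : in_gap x t -> in_gap y t -> x = y.
Proof.
move=> /in_gapP[x1 x2] /in_gapP[y1 y2].
by case: (ltgtP x y) => // /gaps_disjoint; lra.
Qed.

(** The gaps cover the line: the measure has full mass on them. *)
Lemma gap_exists t : exists x, in_gap x t.
Proof.
pose n := Num.floor t; have tn : n%:~R <= t by exact: floor_le_tmp.
have tn1 : t < n%:~R + 1 by rewrite -intrD1 lt_succ_floor.
have cz (k : int) : center k%:~R = k%:~R.
  by rewrite -[X in center X]add0r centerDz center0 add0r.
pose E := [set x | center x - half x <= t].
have Esup : has_sup E.
  split; first by exists n%:~R; rewrite /E/= cz; have := half_ge0 n%:~R; lra.
  exists (n + 1)%:~R => x Ex; rewrite leNgt; apply/negP => /gaps_disjoint.
  move: Ex; rewrite /E/= cz intrD; have := half_ge0 (n%:~R + 1%:~R); lra.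
pose x0 := sup E; exists x0; apply/in_gapP; split.
  rewrite leNgt; apply/negP => lt_t.
  have e0 : 0 < center x0 - half x0 - t by lra.
  have [d d0 md] := mass_ball x0 e0.
  have [y Ey xy] := sup_adherent d0 Esup.
  have yx : y <= x0 by exact: ub_le_sup Esup.2 _ Ey.
  (* The part of the measure between [z] and [x0] is so small that the gap of
     [z] ends after [t], although [z < y] and the gap of [y] starts before
     [t]. *)
  pose z := (x0 - d + y) / 2.
  have [zd zy] : x0 - d < z /\ z < y by rewrite /z -/x0 in xy *; split; lra.
  have zx : z < x0 by exact: lt_le_trans yx.
  have m : fine (mass `]z, x0[) < center x0 - half x0 - t.
    rewrite -lte_fin fineK ?mass_oo_fin//; apply: le_lt_trans md.
    apply: mass_sub => v /=; rewrite !in_itv/= => /andP[v1 v2]; split.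
      by apply/andP; split; lra.
    by apply/eqP; rewrite lt_eqF.
  have := gaps_disjoint zy; have := centerB zx; move: Ey; rewrite /E/=.
  lra.
rewrite leNgt; apply/negP => lt_t.
have e0 : 0 < t - (center x0 + half x0) by lra.
have [d d0 md] := mass_ball x0 e0.
pose y := x0 + d / 2; have xy : x0 < y by rewrite /y; lra.
have m : fine (mass `]x0, y[) < t - (center x0 + half x0).
  rewrite -lte_fin fineK ?mass_oo_fin//; apply: le_lt_trans md.
  apply: mass_sub => v /=; rewrite /y !in_itv/= => /andP[v1 v2]; split.
    by apply/andP; split; lra.
  by apply/eqP; rewrite gt_eqF.
have Ey : E y by have := centerB xy; rewrite /E/=; lra.
by have := ub_le_sup Esup.2 Ey; rewrite leNgt xy.
Qed.

(** The monotone map that collapses every gap to the point it replaces. *)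
Definition collapse t : R := sval (cid (gap_exists t)).

Lemma collapse_gap t : in_gap (collapse t) t.
Proof. by rewrite /collapse; case: cid. Qed.

Lemma collapseE x t : in_gap x t -> collapse t = x.
Proof. by move=> xt; exact: gap_uniq (collapse_gap t) xt. Qed.

Lemma collapse_center x : collapse (center x) = x.
Proof. exact: collapseE (gap_center x). Qed.

Lemma collapseDz t (n : int) : collapse (t + n%:~R) = collapse t + n%:~R.
Proof.
apply: collapseE; have := collapse_gap t.
rewrite /in_gap centerDz half_periodicz.
by rewrite (_ : t + _ - _ = t - center (collapse t)) //; ring.
Qed.

Lemma collapse_le s t : s <= t -> collapse s <= collapse t.
Proof.
move=> st; rewrite leNgt; apply/negP => /gaps_disjoint.
by have /in_gapP[] := collapse_gap s; have /in_gapP[] := collapse_gap t; lra.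
Qed.

Lemma collapse_continuous : continuous collapse.
Proof.
move=> t; apply/cvgrPdist_le => e e0; set x := collapse t.
have [x1 x2] := in_gapP _ _ (collapse_gap t); rewrite -/x in x1 x2.
have /gaps_disjoint L : x - e < x by lra.
have /gaps_disjoint U : x < x + e by lra.
have := half_ge0 (x - e); have := half_ge0 (x + e) => h1 h2.
have : nbhs t `]center (x - e), center (x + e)[%classic.
  by apply: near_in_itvoo; rewrite in_itv/=; apply/andP; split; lra.
apply: filterS => s /=; rewrite in_itv/= => /andP[/ltW s1 /ltW s2].
have := collapse_le s1; have := collapse_le s2; rewrite !collapse_center => ? ?.
by rewrite ler_norml; apply/andP; split; lra.
Qed.

(** * The map of the blown-up line induced by a lift *)

(** Lifts to the line of homeomorphisms of the circle: monotone bijections,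
    increasing if [sg = 1] and decreasing if [sg = -1], that commute up to sign
    with the unit translation. *)
Definition lift (sg : R) (F : R -> R) :=
  [/\ sg = 1 \/ sg = -1, forall x y, x < y -> sg * F x < sg * F y,
      forall y, exists x, F x = y & forall x, F (x + 1) = F x + sg].

(** [F] preserves the set of atoms and changes their masses by a factor that
    tends to 1 along the atoms of the unit interval. *)
Definition tame (F : R -> R) :=
  (forall x, same_gap (half x) (half (F x))) /\
  (forall e : R, 0 < e ->
     finite_set [set x | 0 <= x < 1 /\ e * w x < `|w (F x) - w x|]).

(** The map induced by [F] on the blown-up line: it carries the gap of [x] to
    the gap of [F x], flipped if [F] is decreasing. *)
Definition blow sg F t : R := let x := collapse t in
  center (F x) + sg * gap_map (half x) (half (F x)) (t - center x).

Section one_lift.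
Variables (sg : R) (F : R -> R).
Hypotheses (F_lift : lift sg F) (F_tame : tame F).

Let sgE : sg = 1 \/ sg = -1. Proof. by case: F_lift. Qed.

Lemma sg_sqr : sg * sg = 1.
Proof. by case: sgE => ->; rewrite ?mulrNN mulr1. Qed.

Lemma sg_norm : `|sg| = 1.
Proof. by case: sgE => ->; rewrite ?normrN normr1. Qed.

Lemma lift_inj : injective F.
Proof.
case: F_lift => _ inc _ _ x y xy.
by case: (ltgtP x y) => // /inc; rewrite xy ltxx.
Qed.

Lemma liftDz x (n : int) : F (x + n%:~R) = F x + sg * n%:~R.
Proof. by case: F_lift => _ _ _ F1; exact: (equivariant_int F1). Qed.

Lemma lift_gap x : same_gap (half x) (half (F x)). Proof. exact: F_tame.1. Qed.

(** [lift_mass_oo] is the change of variables under [F] for the measure; with it,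
    [center_liftB] computes increments of [center \o F], as [centerB] does for
    [center], in both orientations at once. *)
Lemma lift_mass_oo x y : x < y ->
  (\esum_(z in `]x, y[) (w (F z))%:E =
   mass (if (sg == 1)%R then `]F x, F y[%classic else `]F y, F x[%classic))%E.
Proof.
move=> xy; rewrite /mass; apply/esym/reindex_esum.
case: F_lift => _ inc surj _; have iF := lift_inj.
case: sgE inc => -> inc; last first.
  have dec u v : u < v -> F v < F u.
    by move=> /inc; rewrite !mulN1r ltrN2.
  have -> : (-1 == 1 :> R) = false by apply/negbTE; rewrite lt_eqF//; lra.
  split => [z|u v _ _ /iF//|z] /=; rewrite !in_itv/=.
    by move=> /andP[/dec -> /dec ->].
  have [u <-] := surj z => /andP[yu ux]; exists u => //=.
  rewrite in_itv/= !ltNge; apply/andP; split; apply/negP.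
    by rewrite le_eqVlt => /predU1P[ux'|/dec]; [rewrite ux' ltxx in ux|lra].
  by rewrite le_eqVlt => /predU1P[yu'|/dec]; [rewrite yu' ltxx in yu|lra].
have {}inc u v : u < v -> F u < F v by move=> /inc; rewrite !mul1r.
rewrite eqxx; split => [z|u v _ _ /iF//|z] /=; rewrite !in_itv/=.
  by move=> /andP[/inc -> /inc ->].
have [u <-] := surj z => /andP[yu ux]; exists u => //=.
rewrite in_itv/= !ltNge; apply/andP; split; apply/negP.
  by rewrite le_eqVlt => /predU1P[ux'|/inc]; [rewrite ux' ltxx in yu|lra].
by rewrite le_eqVlt => /predU1P[yu'|/inc]; [rewrite yu' ltxx in ux|lra].
Qed.

Lemma lift_mass_oo_fin x y : x < y ->
  (\esum_(z in `]x, y[) (w (F z))%:E)%E \is a fin_num.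
Proof. by move=> xy; rewrite lift_mass_oo//; case: ifP => _; exact: mass_oo_fin. Qed.

Lemma center_liftB x y : x < y ->
  sg * (center (F y) - center (F x)) =
  half (F x) + half (F y) + fine (\esum_(z in `]x, y[) (w (F z))%:E)%E.
Proof.
move=> xy; rewrite lift_mass_oo//; case: F_lift => _ inc _ _.
case: sgE inc => -> /(_ _ _ xy).
  by rewrite eqxx !mul1r => /centerB.
have -> : (-1 == 1 :> R) = false by apply/negbTE; rewrite lt_eqF//; lra.
by rewrite !mulN1r ltrN2 opprB [half _ + _]addrC => /centerB.
Qed.

Lemma blow_gap t : in_gap (F (collapse t)) (blow sg F t).
Proof.
rewrite /in_gap /blow addrAC subrr add0r normrM sg_norm mul1r.
by apply: gap_map_le; [exact: lift_gap|exact: collapse_gap].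
Qed.

Lemma collapse_blow t : collapse (blow sg F t) = F (collapse t).
Proof. exact: collapseE (blow_gap t). Qed.

Lemma blowDz t (n : int) : blow sg F (t + n%:~R) = blow sg F t + sg * n%:~R.
Proof.
rewrite /blow collapseDz centerDz half_periodicz liftDz.
have [m ->] := sign_mul_int n sgE.
rewrite centerDz half_periodicz (_ : t + _ - _ = t - center (collapse t)); ring.
Qed.

(** [gap_speed z] is the derivative of [blow sg F], up to sign, inside the gap
    of [z], extended by 1; truncating the distance to the centre at [half z]
    gives this extension since [gap_slope] is 1 at the ends of the gap. The
    derivative at [t] is the contribution [speed t] of the gap of [t]. *)
Definition gap_speed z t : R := if half z == 0 then 1 else
  gap_slope (half z) (half (F z)) (Num.min `|t - center z| (half z)) ^+ 2.

Definition speed t := gap_speed (collapse t) t.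

Lemma gap_speed_out z t : half z <= `|t - center z| -> gap_speed z t = 1.
Proof.
rewrite /gap_speed; case: eqP => // /eqP z0 zt.
have h0 : 0 < half z by rewrite lt_neqAle eq_sym z0 half_ge0.
have hF : 0 < half (F z).
  by have := lift_gap z; rewrite /same_gap (negbTE z0) orbF => /andP[].
by rewrite min_r// gap_slope_bd ?expr1n// ger0_norm// ltW.
Qed.

Lemma gap_speed_in z t : 0 < half z -> in_gap z t ->
  gap_speed z t = gap_slope (half z) (half (F z)) (t - center z) ^+ 2.
Proof.
move=> z0 zt; rewrite /gap_speed gt_eqF// min_l//.
by rewrite /gap_slope normr_id.
Qed.

Lemma gap_speed_continuous z : continuous (gap_speed z).
Proof.
rewrite /gap_speed; have [_|z0] := eqVneq (half z) 0.
  by move=> t; exact: cvg_cst.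
have h0 : 0 < half z by rewrite lt_neqAle eq_sym z0 half_ge0.
have hF : 0 < half (F z).
  by have := lift_gap z; rewrite /same_gap (negbTE z0) orbF => /andP[].
move=> t; pose m s := Num.min `|s - center z| (half z).
have cm : m s @[s --> t] --> m t.
  apply: (@continuous_min R R (fun s => `|s - center z|) (cst (half z)) t); last exact: cvg_cst.
  by apply: cvg_norm; apply: cvgB; [exact: cvg_id|exact: cvg_cst].
have d0 : 0 < half z ^+ 2 + (half (F z) - half z) * `|m t|.
  apply: gap_den_gt0 => //; rewrite ger0_norm ?ge_min ?lexx ?orbT//.
  by rewrite le_min normr_ge0 half_ge0.
have cg : gap_slope (half z) (half (F z)) (m s) @[s --> t] -->
          gap_slope (half z) (half (F z)) (m t).
  apply: cvgM; first exact: cvg_cst.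
  apply: cvgV; first by rewrite lt0r_neq0.
  apply: cvgD; first exact: cvg_cst.
  by apply: cvgM; [exact: cvg_cst|exact: cvg_norm].
by rewrite /continuous_at expr2; under eq_fun do rewrite expr2; exact: (cvgM cg cg).
Qed.

Lemma speed_out z t : z <> collapse t -> gap_speed z t = 1.
Proof.
move=> zt; apply: gap_speed_out; rewrite leNgt; apply/negP => /ltW zt'.
by apply: zt; rewrite (collapseE zt').
Qed.

Lemma speed_ge0 t : 0 <= speed t.
Proof. by rewrite /speed /gap_speed; case: ifP => // _; exact: sqr_ge0. Qed.

(** Away from finitely many gaps the speed is close to 1. *)
Lemma slow_gaps (e : R) : 0 < e -> e <= 1 -> forall x0,
  exists2 Z : set R, finite_set Z & forall z t, x0 - 1 <= z <= x0 + 1 ->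
    ~ Z z -> in_gap z t -> `|gap_speed z t - 1| <= 3 * e.
Proof.
move=> e0 e1 x0; case: F_tame => _ /(_ e e0); set Z := [set x | _] => finZ.
pose m := Num.floor x0; pose Y (k : int) := (fun r => r + k%:~R) @` Z.
exists (Y (m - 1)%R `|` Y m `|` Y (m + 1)%R).
  by rewrite !finite_setU; do ![split]; apply: finite_image.
move=> z t /andP[z1 z2] nYz zt.
have [hz|hz] := eqVneq (half z) 0.
  by rewrite /gap_speed hz eqxx subrr normr0; lra.
have h0 : 0 < half z by rewrite lt_neqAle eq_sym hz half_ge0.
have hF : 0 < half (F z).
  by have := lift_gap z; rewrite /same_gap (negbTE hz) orbF => /andP[].
rewrite gap_speed_in//; apply: gap_slope_near1 => //; first exact: ltW.
have -> : half (F z) - half z = (w (F z) - w z) / 2 by rewrite /half; ring.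
have h2 : `|2^-1| = 2^-1 :> R by rewrite ger0_norm.
rewrite normrM h2 /half mulrA ler_wpM2r// leNgt.
apply/negP => bad; apply: nYz.
pose k := Num.floor z; have kz : k%:~R <= z by exact: floor_le_tmp.
have kz1 : z < k%:~R + 1 by rewrite -intrD1 lt_succ_floor.
have mx : m%:~R <= x0 by exact: floor_le_tmp.
have mx1 : x0 < m%:~R + 1 by rewrite -intrD1 lt_succ_floor.
have Zk : Y k z.
  exists (z - k%:~R); last by rewrite subrK.
  rewrite /Z/= -mulrNz w_periodicz liftDz.
  have [n ->] := sign_mul_int (- k) sgE.
  by rewrite w_periodicz mulrNz subr_ge0 kz ltrBlDr addrC kz1.
have : (k = m - 1 \/ k = m \/ k = m + 1)%R.
  have : ((m - 2)%:~R : R) < k%:~R by rewrite intrB; lra.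
  have : (k%:~R : R) < (m + 2)%:~R by rewrite intrD; lra.
  by rewrite !ltr_int => ? ?; exact: int_near.
by move=> [|[|]] <-; [left; left|left; right|right].
Qed.

(** [speed] is a uniform limit of functions that differ from 1 in finitely many
    gaps only, each contribution [gap_speed z] being continuous. *)
Lemma speed_continuous : continuous speed.
Proof.
move=> t0; apply/cvgrPdist_le => e e0; set x0 := collapse t0.
pose n := Num.min 1 (e / 6).
have n0 : 0 < n by rewrite lt_min ltr01 divr_gt0.
have n1 : n <= 1 by rewrite ge_min lexx.
have ne : 3 * n <= e / 2.
  have : n <= e / 6 by rewrite ge_min lexx orbT.
  lra.
have [Z finZ HZ] := slow_gaps n0 n1 x0.
pose Z' := fset_set ([set x0] `|` Z).
have finZ' : finite_set ([set x0] `|` Z) by rewrite finite_setU; split.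
pose P z t := `|gap_speed z t0 - gap_speed z t| <= e / 2.
have N1 : nbhs t0 (\bigcap_(z in [set` Z']) P z).
  apply: filter_bigI => z _; have := @gap_speed_continuous z t0.
  by move=> /cvgrPdist_le; apply; rewrite divr_gt0.
have N2 : nbhs t0 (ball t0 1) by exact: nbhsx_ballx.
apply: filterS2 N1 N2 => t Pt; rewrite /ball/= => /ltW; rewrite ler_norml => /andP[t1 t2].
have PZ z : z = x0 \/ Z z -> P z t.
  by move=> zZ; apply: Pt; rewrite /Z'/= in_fset_set// inE.
have P0 : P x0 t by apply: PZ; left.
have [c1 c2] : x0 - 1 <= collapse t /\ collapse t <= x0 + 1.
  split; last first.
    by rewrite -(collapseDz t0 1); apply: collapse_le; rewrite mulr1z; lra.
  by rewrite -(collapseDz t0 (-1)); apply: collapse_le; rewrite mulrN1z; lra.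
rewrite {1}/speed -/x0 /speed.
have [xx|xx] := eqVneq (collapse t) x0.
  by rewrite xx; apply: (le_trans P0); lra.
move: P0; rewrite /P (speed_out (t := t) (z := x0)); last by move=> E; rewrite E eqxx in xx.
move=> P0.
have [Zt|Zt] := pselect (Z (collapse t)).
  have := PZ _ (or_intror Zt); rewrite /P (speed_out (t := t0)); last first.
    by move=> E; rewrite E eqxx in xx.
  by move: P0; rewrite !ler_norml => /andP[? ?] /andP[? ?]; apply/andP; split; lra.
have := HZ _ t _ Zt (collapse_gap t); rewrite c1 c2 => /(_ isT).
by move: P0; rewrite !ler_norml => /andP[? ?] /andP[? ?]; apply/andP; split; lra.
Qed.

Lemma gap_map_end z :
  gap_map (half z) (half (F z)) (half z) = half (F z).
Proof.
case/orP: (lift_gap z) => /andP[] => [z0 Fz0|/eqP -> /eqP ->]; last exact: gap_map00.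
rewrite /gap_map ger0_norm ?half_ge0//.
have -> : half z ^+ 2 + (half (F z) - half z) * half z = half z * half (F z) by ring.
by field; rewrite !lt0r_neq0.
Qed.

(** Mean value inequality within one gap. *)
Lemma gap_mvt z l u r r' : - half z <= r -> r <= r' -> r' <= half z ->
  (forall t, center z + r <= t <= center z + r' -> l <= speed t <= u) ->
  l * (r' - r) <=
    gap_map (half z) (half (F z)) r' - gap_map (half z) (half (F z)) r <=
    u * (r' - r).
Proof.
move=> zr rr' r'z H; have [hz|hz] := eqVneq (half z) 0.
  have -> : r = 0 by lra.
  have -> : r' = 0 by lra.
  by rewrite !subrr !mulr0 lexx.
have h0 : 0 < half z by rewrite lt_neqAle eq_sym hz half_ge0.
apply: gap_map_mvt => // [|x /andP[rx xr']]; first exact: lift_gap.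
have zx : in_gap z (center z + x) by apply/in_gapP; split; lra.
have := H (center z + x); rewrite /speed (collapseE zx) gap_speed_in//.
have -> : center z + x - center z = x by ring.
by apply; apply/andP; split; lra.
Qed.

(** The mean value inequality for [blow sg F] on a segment, by addition over all
    the gaps that meet the segment: these have full measure, in the source and
    in the target. *)
Lemma blow_mvt s t l u : s <= t ->
  (forall r, s <= r <= t -> l <= speed r <= u) ->
  l * (t - s) <= sg * (blow sg F t - blow sg F s) <= u * (t - s).
Proof.
move=> st H; set x := collapse s; set y := collapse t.
have [xs1 xs2] := in_gapP _ _ (collapse_gap s); rewrite -/x in xs1 xs2.
have [yt1 yt2] := in_gapP _ _ (collapse_gap t); rewrite -/y in yt1 yt2.
pose g z r := gap_map (half z) (half (F z)) r.
have E : sg * (blow sg F t - blow sg F s) =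
    sg * (center (F y) - center (F x)) + (g y (t - center y) - g x (s - center x)).
  rewrite /blow -/x -/y -/(g _ _) -/(g _ _).
  transitivity (sg * (center (F y) - center (F x)) +
      sg * sg * (g y (t - center y) - g x (s - center x))); first ring.
  by rewrite sg_sqr mul1r.
rewrite E; have := collapse_le st; rewrite -/x -/y le_eqVlt => /predU1P[xy|xy].
  rewrite -xy subrr mulr0 add0r.
  have -> : t - s = (t - center x) - (s - center x) by ring.
  rewrite -xy in yt1 yt2.
  by apply: gap_mvt => [|||r /andP[? ?]]; try lra; apply: H; apply/andP; split; lra.
rewrite (center_liftB xy).
have cyx := centerB xy; set m := fine (mass _) in cyx.
have m0 : 0 <= m by exact: ltW (mass_oo_gt0 xy).
have m_fin : mass `]x, y[ = m%:E by rewrite fineK// mass_oo_fin.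
set M := fine _.
have M_fin : (\esum_(z in `]x, y[) (w (F z))%:E)%E = M%:E.
  by rewrite fineK// lift_mass_oo_fin.
have M0 : 0 <= M.
  by rewrite -lee_fin -M_fin; apply: esum_ge0 => z _; rewrite lee_fin.
(* The end of the gap of [x], and below the beginning of the gap of [y]. *)
have /andP[X1 X2] : l * (half x - (s - center x)) <=
    g x (half x) - g x (s - center x) <= u * (half x - (s - center x)).
  apply: gap_mvt; try lra; move=> r /andP[? ?].
  by apply: H; have ? := half_ge0 y; apply/andP; split; lra.
have /andP[Y1 Y2] : l * ((t - center y) - - half y) <=
    g y (t - center y) - g y (- half y) <= u * ((t - center y) - - half y).
  apply: gap_mvt; try lra; move=> r /andP[? ?].
  by apply: H; have ? := half_ge0 x; apply/andP; split; lra.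
have Ex : g x (half x) = half (F x) by exact: gap_map_end.
have Ey : g y (- half y) = - half (F y) by rewrite /g gap_mapN gap_map_end.
have u0 : 0 <= u.
  have /andP[_ us] := H s (introT andP (conj (lexx _) st)).
  exact: le_trans (speed_ge0 s) us.
(* A whole gap: [gap_mvt] between its two ends. *)
have W z : x < z < y -> l * w z <= w (F z) <= u * w z.
  move=> /andP[xz zy]; have := gaps_disjoint xz; have := gaps_disjoint zy => ? ?.
  have /andP[] : l * (half z - - half z) <= g z (half z) - g z (- half z) <=
      u * (half z - - half z).
    have hz := half_ge0 z; apply: gap_mvt; try lra; move=> r /andP[? ?].
    by apply: H; apply/andP; split; lra.
  by rewrite /g gap_mapN gap_map_end /half => ? ?; apply/andP; split; lra.
have Mu : M <= u * m.
  rewrite -lee_fin EFinM -m_fin -M_fin; apply: esum_le_scale => // z /=.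
  by rewrite in_itv/= => zxy; have /andP[] := W z zxy.
have Ml : l * m <= M.
  have [l0|l0] := leP l 0; first by apply: le_trans M0; rewrite mulr_le0_ge0.
  rewrite -ler_pdivlMl// -lee_fin EFinM -m_fin -M_fin.
  apply: esum_le_scale => // [|z]; first by rewrite invr_ge0 ltW.
  by rewrite /= in_itv/= => zxy; have /andP[? _] := W z zxy; rewrite ler_pdivlMl.
have -> : t - s = (half x - (s - center x)) + m + ((t - center y) - - half y).
  lra.
by apply/andP; split; rewrite !mulrDr; lra.
Qed.

(** [blow sg F] is differentiable with derivative [sg * speed]. *)
Lemma blow_diff t0 (e : R) : 0 < e -> exists2 d : R, 0 < d &
  forall t, `|t - t0| < d ->
    `|blow sg F t - blow sg F t0 - sg * speed t0 * (t - t0)| <= e * `|t - t0|.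
Proof.
move=> e0; have /cvgrPdist_le/(_ e e0)/nbhs_ballP[d /= d0 Hd] := @speed_continuous t0.
exists d => // t td.
have B r : `|r - t0| < d -> speed t0 - e <= speed r <= speed t0 + e.
  move=> rd; have := Hd r; rewrite /ball/= distrC => /(_ rd).
  by rewrite ler_norml => /andP[? ?]; apply/andP; split; lra.
have N : `|blow sg F t - blow sg F t0 - sg * speed t0 * (t - t0)| =
    `|sg * (blow sg F t - blow sg F t0) - speed t0 * (t - t0)|.
  rewrite -[LHS]mul1r -sg_norm -normrM; congr `|_|.
  transitivity (sg * (blow sg F t - blow sg F t0) - sg * sg * (speed t0 * (t - t0))).
    ring.
  by rewrite sg_sqr mul1r.
move: td; rewrite N ltr_norml => /andP[td1 td2].
have [tt|tt] := leP t0 t.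
  have /andP[? ?] : (speed t0 - e) * (t - t0) <=
      sg * (blow sg F t - blow sg F t0) <= (speed t0 + e) * (t - t0).
    apply: blow_mvt => // r /andP[? ?]; apply: B.
    by rewrite ltr_norml; apply/andP; split; lra.
  have -> : `|t - t0| = t - t0 by rewrite ger0_norm// subr_ge0.
  by rewrite ler_norml; apply/andP; split; lra.
have /andP[? ?] : (speed t0 - e) * (t0 - t) <=
    sg * (blow sg F t0 - blow sg F t) <= (speed t0 + e) * (t0 - t).
  apply: blow_mvt => [|r /andP[? ?]]; first exact: ltW.
  by apply: B; rewrite ltr_norml; apply/andP; split; lra.
have -> : `|t - t0| = t0 - t by rewrite ltr0_norm ?opprB// subr_lt0.
by rewrite ler_norml; apply/andP; split; lra.
Qed.

Lemma blow_is_derive t : is_derive t 1 (blow sg F) (sg * speed t).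
Proof.
have : h^-1 *: (blow sg F (h *: 1 + t) - blow sg F t) @[h --> 0^'] --> sg * speed t.
  apply/cvgrPdist_le => e e0; have [d d0 H] := blow_diff t e0.
  near=> h; have h0 : h != 0 by near: h; exact: nbhs_dnbhs_neq.
  have hd : `|h| < d by near: h; exact: dnbhs0_lt.
  have := H (h + t); rewrite addrK => /(_ hd) {}H.
  rewrite distrC [h *: 1]mulr1.
  have -> : h^-1 *: (blow sg F (h + t) - blow sg F t) - sg * speed t =
      h^-1 * (blow sg F (h + t) - blow sg F t - sg * speed t * h).
    by rewrite [in RHS]mulrBr mulrCA mulVf// mulr1.
  by rewrite normrM normfV ler_pdivrMl ?normr_gt0// (mulrC `|h|).
move=> c; split; first exact: (cvgP _ c).
exact: (cvg_lim (@norm_hausdorff _ _) c).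
Unshelve. all: by end_near. Qed.

Lemma blow_continuous : continuous (blow sg F).
Proof.
move=> t; apply/differentiable_continuous/derivable1_diffP.
by have [] := blow_is_derive t.
Qed.

End one_lift.

Lemma blow_comp sg1 F1 sg2 F2 t : lift sg2 F2 -> tame F1 -> tame F2 ->
  blow sg1 F1 (blow sg2 F2 t) = blow (sg1 * sg2) (F1 \o F2) t.
Proof.
move=> L2 T1 T2; rewrite {1}/blow collapse_blow// /blow /=; set x := collapse t.
rewrite [_ + _ - center (F2 x)]addrAC subrr add0r.
have -> r : gap_map (half (F2 x)) (half (F1 (F2 x))) (sg2 * r) =
    sg2 * gap_map (half (F2 x)) (half (F1 (F2 x))) r.
  by case: L2 => -[] -> _ _ _; rewrite ?mul1r// !mulN1r gap_mapN.
rewrite gap_mapK ?mulrA//; [exact: T2.1|exact: T1.1|exact: collapse_gap].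
Qed.

(** [blow sg F t] depends on [F] only through its value at [collapse t]. *)
Lemma blow_ext sg F F' t (n : int) :
  F' (collapse t) = F (collapse t) + n%:~R ->
  blow sg F' t = blow sg F t + n%:~R.
Proof. by move=> E; rewrite /blow E centerDz half_periodicz addrAC. Qed.

Lemma blow_id t : blow 1 id t = t.
Proof.
rewrite /blow; set x := collapse t.
have -> : gap_map (half x) (half x) (t - center x) = t - center x.
  by apply: gap_map_id; exact: collapse_gap.
by rewrite mul1r addrC subrK.
Qed.

End atomic_line.

(** * Slowly varying summable weights on orbits *)

Section weights.
Variables (R : realType) (G : groupType) (T : topologicalType).
Variables (rho : G -> T -> T) (e : nat -> G) (d : nat -> T).
Hypothesis rho1 : forall x, rho 1%g x = x.
Hypothesis rhoM : forall g h x, rho (g * h)%g x = rho g (rho h x).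
Hypothesis rho_subexp : subexponential_orbits R rho.
Hypothesis e_surj : forall g, exists n, e n = g.

(** The points reached from [x] by products of [n] elements of [S]. *)
Definition sphere (S : {fset G}) n x : {fset T} :=
  [fset rho g x | g in fset_exp S n]%fset.

Lemma sphereS S n x y g : g \in S -> y \in sphere S n x ->
  rho g y \in sphere S n.+1 x.
Proof.
move=> gS /imfsetP[h /= hS ->]; rewrite -rhoM; apply/imfsetP.
by exists (g * h)%g => //=; apply/imfset2P; exists g => //; exists h.
Qed.

Lemma sphere0 S x : x \in sphere S 0 x.
Proof. by apply/imfsetP; exists 1%g; rewrite ?rho1//= in_fset1. Qed.

Lemma fset_exp_sub (S S' : {fset G}) n : (S `<=` S')%fset ->
  (fset_exp S n `<=` fset_exp S' n)%fset.
Proof.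
move=> SS'; elim: n => [|n IH] //=; apply/fsubsetP => g.
case/imfset2P => s /= sS [t /= tS ->]; apply/imfset2P.
by exists s; [exact: (fsubsetP SS')|exists t => //; exact: (fsubsetP IH)].
Qed.

Lemma sphere_sub (S S' : {fset G}) n x : (S `<=` S')%fset ->
  (sphere S n x `<=` sphere S' n x)%fset.
Proof.
move=> SS'; apply/fsubsetP => y /imfsetP[g /= gS ->]; apply/imfsetP.
by exists g => //=; apply: (fsubsetP (fset_exp_sub n SS')).
Qed.

Lemma sphere_growth (S : {fset G}) x (q : R) : S != fset0 -> 1 < q ->
  exists2 C : R, 1 <= C & forall n, #|` sphere S n x|%:R <= C * q ^+ n.
Proof.
move=> S0 q1; have /cvgrPdist_le := rho_subexp x S0.
have e0 : 0 < q - 1 by rewrite subr_gt0.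
move=> /(_ _ e0)[N _ HN]; have q0 : 0 <= q by rewrite (le_trans ler01)// ltW.
exists (1 + \sum_(i < N.+1) #|` sphere S i x|%:R) => [|n].
  by rewrite lerDl sumr_ge0.
have [nN|Nn] := ltnP n N.+1.
  have qn : 1 <= q ^+ n by rewrite exprn_ege1// ltW.
  apply: (@le_trans _ _ (1 + \sum_(i < N.+1) #|` sphere S i x|%:R)).
    rewrite (bigD1 (Ordinal nN))//= addrCA lerDl addr_ge0// sumr_ge0//.
  by rewrite ler_peMr// addr_ge0// sumr_ge0.
have {Nn}[n0 Nn] : (0 < n)%N /\ (N <= n)%N by split; [exact: leq_trans Nn|exact: ltnW].
have := HN n Nn; rewrite distrC => /(le_trans (ler_norm _)).
rewrite lerBlDr subrK -/(sphere S n x); set c := #|` _|%:R => cq.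
have c0 : 0 <= c by [].
apply: (@le_trans _ _ (q ^+ n)); last first.
  by rewrite ler_peMl ?exprn_ge0// lerDl sumr_ge0.
rewrite -[c]powRr1// -(@mulVf _ (n%:R)) ?pnatr_eq0 -?lt0n//.
by rewrite powRrM powR_mulrn ?powR_ge0// lerXn2r// nnegrE powR_ge0.
Qed.

(** The first elements in the enumeration [e] of the group. *)
Definition gens k : {fset G} := [fset e i | i in iota 0 k.+1]%fset.

(** The points reached in [n] steps of [gens k] from the first starting points
    [d i]. *)
Definition reached k n : {fset T} :=
  (\bigcup_(i <- iota 0 k.+1) sphere (gens k) n (d i))%fset.

Lemma reachedP k n y :
  reflect (exists2 i, (i <= k)%N & y \in sphere (gens k) n (d i))
    (y \in reached k n).
Proof.
rewrite /reached; apply: (iffP (bigfcupP _ _ _ _)) => [[i /andP[]]|[i ik yi]].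
  by rewrite mem_iota add0n ltnS /= => ? _ ?; exists i.
by exists i => //; rewrite mem_iota add0n ltnS ik.
Qed.

Lemma gensP k g : reflect (exists2 i, (i <= k)%N & g = e i) (g \in gens k).
Proof.
rewrite /gens; apply: (iffP (imfsetP _ _ _ _)) => -[i ik ->]; exists i => //.
  by have : i \in iota 0 k.+1 by []; rewrite mem_iota add0n ltnS.
by apply: (_ : i \in iota 0 k.+1); rewrite mem_iota add0n ltnS.
Qed.

Lemma gens_sub k l : (k <= l)%N -> (gens k `<=` gens l)%fset.
Proof.
move=> kl; apply/fsubsetP => g /gensP[i ik ->]; apply/gensP.
by exists i => //; exact: leq_trans kl.
Qed.

Lemma gens_neq0 k : gens k != fset0.
Proof. by apply/fset0Pn; exists (e 0%N); apply/gensP; exists 0%N. Qed.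

Lemma reachedS k n g y : g \in gens k -> y \in reached k n ->
  rho g y \in reached k n.+1.
Proof.
move=> gk /reachedP[i ik yi]; apply/reachedP; exists i => //; exact: sphereS.
Qed.

Lemma reached_sub k l n y : (k <= l)%N -> y \in reached k n -> y \in reached l n.
Proof.
move=> kl /reachedP[i ik yi]; apply/reachedP.
exists i; first exact: leq_trans kl.
exact: (fsubsetP (sphere_sub n (d i) (gens_sub kl))).
Qed.

(* A point reached in [n] steps at level [k] is given the value
   [coef k * rate k ^+ n]. The ratio [rate k], the square of [root k], tends to
   1; as the spheres of level [k] grow at most like [(root k)^-1 ^+ n], the sum
   over a level is bounded by a geometric series of ratio [root k], and [coef k]
   makes the sum over all levels converge. *)
Let root k : R := k.+1%:R / k.+2%:R.
Let rate k : R := root k ^+ 2.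

Let root_gt0 k : 0 < root k. Proof. by rewrite divr_gt0. Qed.
Let root_lt1 k : root k < 1.
Proof. by rewrite ltr_pdivrMr// mul1r ltr_nat. Qed.

Let root_lt k l : (k < l)%N -> root k < root l.
Proof.
move=> kl; rewrite /root ltr_pdivrMr// mulrAC ltr_pdivlMr//.
have : k%:R < l%:R :> R by rewrite ltr_nat.
rewrite -!natr1; lra.
Qed.

Let rate_gt0 k : 0 < rate k. Proof. exact: exprn_gt0. Qed.
Let rate_le1 k : rate k <= 1.
Proof. by rewrite exprn_ile1// ltW. Qed.

Let rate_lt k l : (k < l)%N -> rate k < rate l.
Proof.
by move=> kl; rewrite /rate ltrXn2r ?ltW ?root_lt.
Qed.

Let rate_near1 (b : R) : 0 < b -> exists K, forall k, (K <= k)%N -> 1 - b <= rate k.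
Proof.
move=> b0; pose K := Num.trunc (2 / b); exists K => k Kk.
have kb : 2 / b < k.+1%:R.
  by apply: lt_le_trans (truncnS_gt _) _; rewrite ler_nat ltnS.
have k1 : 0 < k.+2%:R :> R by [].
have E : root k = 1 - k.+2%:R^-1.
  by rewrite /root -[in k.+1%:R](addrK 1 k.+1%:R) natr1 mulrBl divff ?mul1r ?pnatr_eq0.
have V : k.+2%:R^-1 <= b / 2.
  rewrite -[b / 2]invrK invf_div lef_pV2 ?posrE ?divr_gt0//.
  by apply: (le_trans (ltW kb)); rewrite ler_nat.
have V0 : 0 < k.+2%:R^-1 :> R by rewrite invr_gt0.
rewrite /rate E; set v := _^-1 in V V0 *.
by have := sqr_ge0 v; lra.
Qed.

Let reached_growth k : exists2 C : R, 1 <= C &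
  forall n, #|` reached k n|%:R * rate k ^+ n <= C * root k ^+ n.
Proof.
have q1 : 1 < (root k)^-1 by rewrite invf_gt1.
have /choice[C HC] : forall i, exists C : R, 1 <= C /\
    forall n, #|` sphere (gens k) n (d i)|%:R <= C * (root k)^-1 ^+ n.
  by move=> i; have [C ? ?] := sphere_growth (d i) (gens_neq0 k) q1; exists C.
exists (\sum_(i <- iota 0 k.+1) C i) => [|n].
  rewrite big_cons (le_trans (HC 0%N).1)// lerDl sumr_ge0// => i _.
  exact: le_trans (HC i).1.
have : #|` reached k n|%:R <= (\sum_(i <- iota 0 k.+1) C i) * (root k)^-1 ^+ n.
  rewrite /reached; elim: (iota 0 k.+1) => [|i s IH].
    by rewrite !big_nil cardfs0 mul0r.
  rewrite !big_cons mulrDl; apply: le_trans (lerD ((HC i).2 n) IH).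
  by rewrite -natrD ler_nat cardfsU leq_subr.
rewrite exprVn ler_pdivlMr ?exprn_gt0// => H.
by rewrite /rate -exprM mul2n -addnn exprD mulrA ler_wpM2r// exprn_ge0// ltW.
Qed.

Let bound k : R := s2val (cid2 (reached_growth k)).
Let bound_ge1 k : 1 <= bound k. Proof. by rewrite /bound; case: cid2. Qed.
Let boundP k n : #|` reached k n|%:R * rate k ^+ n <= bound k * root k ^+ n.
Proof. by rewrite /bound; case: cid2. Qed.

Let coef k : R := 2^-1 ^+ k / (bound k * k.+2%:R).
Let coef_gt0 k : 0 < coef k.
Proof.
by rewrite divr_gt0 ?exprn_gt0 ?mulr_gt0// (lt_le_trans ltr01).
Qed.
Let coef_le1 k : coef k <= 1.
Proof.
have b0 : 0 < bound k by exact: lt_le_trans (bound_ge1 k).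
rewrite ler_pdivrMr ?mulr_gt0// mul1r; apply: (@le_trans _ _ 1).
  by apply: exprn_ile1; rewrite ?invr_ge0// invf_le1// ler1n.
by apply: mulr_ege1; rewrite ?ler1n.
Qed.

Let value k n := coef k * rate k ^+ n.
Let value_gt0 k n : 0 < value k n.
Proof. by rewrite mulr_gt0// exprn_gt0. Qed.
Let value_le1 k n : value k n <= 1.
Proof. by apply: mulr_ile1; rewrite ?exprn_ile1 ?exprn_ge0// ltW. Qed.

Let value_sum K N :
  \sum_(k < K) \sum_(n < N) #|` reached k n|%:R * value k n <= 2.
Proof.
have geo (r : R) m : 0 <= r -> r < 1 -> \sum_(i < m) r ^+ i <= (1 - r)^-1.
  move=> r0 r1; rewrite -[leRHS]mul1r ler_pdivlMr ?subr_gt0//.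
  by rewrite mulrC -opprB mulNr -subrX1 opprB lerBlDr lerDl exprn_ge0.
apply: (@le_trans _ _ (\sum_(k < K) 2^-1 ^+ k)); last first.
  have E : (1 - 2^-1)^-1 = 2 :> R.
    by rewrite (_ : 1 - 2^-1 = 2^-1) ?invrK//; lra.
  by rewrite -[leRHS]E; apply: geo; lra.
apply: ler_sum => k _; apply: (@le_trans _ _
    (\sum_(n < N) coef k * bound k * root k ^+ n)).
  apply: ler_sum => n _; rewrite /value mulrCA -mulrA ler_wpM2l// ltW//.
have b0 : 0 < bound k by exact: lt_le_trans (bound_ge1 k).
rewrite -mulr_sumr; apply: (@le_trans _ _ (coef k * bound k * (1 - root k)^-1)).
  by apply: ler_wpM2l; [rewrite mulr_ge0 ?ltW|apply: geo; rewrite ?ltW].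
have -> : (1 - root k)^-1 = k.+2%:R.
  rewrite -[RHS]invrK; congr _^-1; rewrite /root -[in k.+1%:R](addrK 1 k.+1%:R).
  by rewrite natr1 mulrBl divff ?pnatr_eq0// opprB addrCA subrr addr0 mul1r.
by rewrite /coef -mulrA divfK// mulf_neq0 ?pnatr_eq0// gt_eqF.
Qed.

(** The weight of a point is the supremum of its values over all the levels and
    numbers of steps at which it is reached; it is 0 if the point is never
    reached, by the convention on the empty set. *)
Definition weight y : R :=
  sup [set v | exists k n, y \in reached k n /\ v = value k n].

Let weight_ubound y :
  has_ubound [set v | exists k n, y \in reached k n /\ v = value k n].
Proof. by exists 1 => _ [k [n [_ ->]]]. Qed.

Let weight_ge y k n : y \in reached k n -> value k n <= weight y.
Proof. by move=> yk; apply: ub_le_sup => //; exists k, n. Qed.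

Lemma weight_ge0 y : 0 <= weight y.
Proof.
rewrite /weight; set V := [set v | _].
have [->|/set0P[v Vv]] := eqVneq V set0; first by rewrite sup0.
apply: (@le_trans _ _ v); last exact: (ub_le_sup (weight_ubound y)).
by case: Vv => k [n [_ ->]]; exact: ltW.
Qed.

Let weight_gt y v : 0 <= v -> v < weight y ->
  exists k n, y \in reached k n /\ v < value k n.
Proof.
rewrite /weight; set V := [set v | _] => v0.
have [->|/set0P V0] := eqVneq V set0.
  by rewrite sup0 => /(le_lt_trans v0); rewrite ltxx.
move=> /(sup_gt V0)[_ [k [n [yk ->]]] vk].
by exists k, n.
Qed.

Lemma weight_gt0P y : 0 < weight y <-> exists g i, y = rho g (d i).
Proof.
split=> [/(weight_gt (lexx _))[k [n [/reachedP[i _ /imfsetP[g _ ->]] _]]]|].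
  by exists g, i.
move=> [g [i ->]]; have [j jg] := e_surj g.
apply: (@lt_le_trans _ _ (value (maxn i j) 1)) => //; apply: weight_ge.
apply/reachedP; exists i; first exact: leq_maxl.
by apply: sphereS (sphere0 _ _); apply/gensP; exists j; rewrite ?leq_maxr.
Qed.

(** Up to a factor 2, every positive weight is attained by one of the values. *)
Lemma weight_summable : (\esum_(y in [set: T]) (weight y)%:E < +oo)%E.
Proof.
apply: (@le_lt_trans _ _ 4%:E); last exact: ltry.
apply: ge_ereal_sup => _ [X [finX _] <-].
rewrite fsbig_finite//= sumEFin lee_fin; set F := fset_set X.
have /choice[f Hf] : forall y, exists p : nat * nat, 0 < weight y ->
    y \in reached p.1 p.2 /\ weight y / 2 < value p.1 p.2.
  move=> y; have [y0|y0] := ltP 0 (weight y); last by exists (0, 0)%N.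
  have y2 : weight y / 2 < weight y by rewrite ltr_pdivrMr// ltr_pMr// ltr1n.
  have [k [n kn]] := weight_gt (divr_ge0 (ltW y0) (ler0n _ 2)) y2.
  by exists (k, n).
pose K := \max_(y <- F) (f y).1.+1; pose N := \max_(y <- F) (f y).2.+1.
apply: (@le_trans _ _ (\sum_(y <- F)
    \sum_(k < K) \sum_(n < N) 2 * (value k n * (y \in reached k n)%:R))).
  rewrite big_seq [leRHS]big_seq; apply: ler_sum => y yF.
  have nn k n : 0 <= 2 * (value k n * (y \in reached k n)%:R).
    by apply: mulr_ge0 => //; apply: mulr_ge0 => //; exact: ltW.
  have [y0|y0] := ltP 0 (weight y); last first.
    apply: (le_trans y0); apply: sumr_ge0 => k _; exact: sumr_ge0.
  have [fy1 fy2] := Hf y y0.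
  have kK : ((f y).1 < K)%N.
    exact: (@leq_bigmax_seq T (enum_fset F) xpredT (fun y => (f y).1.+1) y yF isT).
  have nN : ((f y).2 < N)%N.
    exact: (@leq_bigmax_seq T (enum_fset F) xpredT (fun y => (f y).2.+1) y yF isT).
  rewrite (bigD1 (Ordinal kK))//= (bigD1 (Ordinal nN))//= fy1 mulr1 -addrA.
  rewrite ler_wpDr ?addr_ge0 ?sumr_ge0// => [k _|]; first exact: sumr_ge0.
  by rewrite mulrC -ler_pdivrMr// ltW.
rewrite exchange_big/=; under eq_bigr do rewrite exchange_big/=.
apply: (@le_trans _ _ (2 * \sum_(k < K) \sum_(n < N) #|` reached k n|%:R * value k n)).
  rewrite mulr_sumr; apply: ler_sum => k _; rewrite mulr_sumr; apply: ler_sum => n _.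
  rewrite -mulr_sumr ler_wpM2l// -mulr_sumr mulrC ler_wpM2r//; first exact: ltW.
  rewrite -natr_sum ler_nat.
  have -> : (\sum_(y <- F) (y \in reached k n))%N = count (mem (reached k n)) F.
    by rewrite -sum1_count [RHS]big_mkcond; apply: eq_bigr => y _ /=; case: ifP.
  rewrite -size_filter uniq_leq_size ?filter_uniq// => y.
  by rewrite mem_filter => /andP[].
have := value_sum K N; lra.
Qed.

(** No group element decreases the weights by more than a factor tending to 1.
    Fix a level [K] from which [g] belongs to [gens k] and [rate k] is close to
    1. Apart from finitely many points, the values of level at least [K]
    determine the weight, since those of a level below [K] decrease faster in
    [n]; and one step by [g] costs a factor [rate k]. *)
Lemma weight_ratio g (b : R) : 0 < b ->
  finite_set [set y | weight (rho g y) < (1 - b) * weight y].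
Proof.
move=> b0; have [K1 HK1] := rate_near1 b0; have [j jg] := e_surj g.
pose K := maxn K1 j.
have gK k : (K <= k)%N -> g \in gens k.
  move=> Kk; apply/gensP; exists j => //.
  by rewrite (leq_trans _ Kk)// leq_maxr.
have /choice[N HN] : forall k, exists N, (k < K)%N -> forall n, (N <= n)%N ->
    value k n <= value K n.
  move=> k; have [kK|] := ltnP k K; last by exists 0%N.
  have q0 : 0 <= rate k / rate K by rewrite divr_ge0// ltW.
  have q1 : rate k / rate K < 1 by rewrite ltr_pdivrMr// mul1r rate_lt.
  have /cvgrPdist_le : (rate k / rate K) ^+ n @[n --> \oo] --> 0.
    by apply: cvg_expr; rewrite ger0_norm.
  have cK : 0 < coef K / coef k by rewrite divr_gt0.
  move=> /(_ _ cK)[N _ HN]; exists N => _ n /HN /=.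
  rewrite sub0r normrN ger0_norm ?exprn_ge0// expr_div_n.
  by rewrite ler_pdivrMr ?exprn_gt0// mulrAC ler_pdivlMr// mulrC.
apply: (@sub_finite_set _ _
  (\bigcup_(k in `I_K) \bigcup_(n in `I_(N k)) [set` reached k n])); last first.
  apply: bigcup_finite => [|k _]; first exact: finite_II.
  by apply: bigcup_finite => [|n _]; [exact: finite_II|exact: finite_fset].
move=> y /= bad; apply: contrapT => Ny.
move: bad; apply/negP; rewrite -leNgt.
have rK : 1 - b <= rate K by apply: HK1; exact: leq_maxl.
apply: (@le_trans _ _ (rate K * weight y)); first by rewrite ler_wpM2r ?weight_ge0.
rewrite mulrC -ler_pdivlMr// leNgt; apply/negP => /weight_gt.
rewrite divr_ge0 ?weight_ge0 ?ltW// => /(_ isT)[k [n [yk]]].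
rewrite ltr_pdivrMr// ltNge => /negP; apply.
have [kK|Kk] := ltnP k K.
  have Nn : (N k <= n)%N.
    by rewrite leqNgt; apply/negP => nN; apply: Ny; exists k => //; exists n.
  apply: (@le_trans _ _ (value K n.+1)).
    have := HN k kK n Nn; rewrite /value exprSr mulrA => vk.
    by apply: ler_wpM2r => //; exact: ltW.
  apply: weight_ge; apply: reachedS; first exact: gK.
  by apply: reached_sub yk; exact: ltnW.
apply: (@le_trans _ _ (value k n.+1)).
  rewrite /value exprSr mulrA; apply: ler_wpM2l.
    by rewrite mulr_ge0 ?exprn_ge0// ltW.
  by move: Kk; rewrite leq_eqVlt => /predU1P[->//|/rate_lt/ltW].
by apply: weight_ge; apply: reachedS yk; exact: gK.
Qed.

End weights.

(** * Blow-up of an action lifted to the line *)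

(** A continuous map from a compact space onto a Hausdorff space is closed, so
    it pulls connected sets back to connected sets once its fibres are
    connected. *)
Lemma connected_preimage (X Y : topologicalType) (h : X -> Y) :
  compact [set: X] -> hausdorff_space Y -> continuous h ->
  (forall y, exists x, h x = y) -> (forall y, connected (h @^-1` [set y])) ->
  forall J, connected J -> connected (h @^-1` J).
Proof.
move=> cX hY ch sh ch1 J cJ B [b Bb] [U oU BU] [K cK BK].
have closed_img C : closed C -> closed (h @` C).
  move=> cC; apply: compact_closed => //; apply: continuous_compact.
    exact: continuous_subspaceT.
  exact: (subclosed_compact cC cX).
have Jb : J (h b) by move: Bb; rewrite BU => -[].
have fib x : B x -> h @^-1` [set h x] `<=` B.
  move=> Bx; have Jx : J (h x) by move: Bx; rewrite BU => -[].
  have E : B `&` h @^-1` [set h x] = h @^-1` [set h x].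
    apply: (ch1 (h x)); first by exists x.
    - exists U => //; rewrite BU; apply/seteqP; split=> [z [[? ?] ?]|z [hz Uz]].
        by split.
      by split => //; split => //; rewrite /preimage/= hz.
    - exists K => //; rewrite BK; apply/seteqP; split=> [z [[? ?] ?]|z [hz Kz]].
        by split.
      by split => //; split => //; rewrite /preimage/= hz.
  by rewrite -E => z [].
have E : h @` B = J.
  apply: cJ; first by exists (h b), b.
  - exists (~` (h @` (~` U))); first by rewrite openC; apply: closed_img; rewrite closedC.
    apply/seteqP; split => [_ [x Bx <-]|y [Jy Uy]].
      split; first by move: Bx; rewrite BU => -[].
      by move=> [z nUz hz]; have /fib := Bx => /(_ z hz); rewrite BU => -[].
    have [x xy] := sh y; exists x => //; rewrite BU; split.
      by rewrite /preimage/= xy.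
    by apply: contrapT => nUx; apply: Uy; exists x.
  - exists (h @` K); first exact: closed_img.
    apply/seteqP; split => [_ [x Bx <-]|y [Jy [x Kx xy]]].
      by move: Bx; rewrite BK => -[? ?]; split => //; exists x.
    by exists x => //; rewrite BK; split => //; rewrite /preimage/= xy.
apply/seteqP; split => [z|z Jz]; first by rewrite BU => -[].
have : (h @` B) (h z) by rewrite E.
by move=> [x Bx xz]; apply: (fib x Bx); rewrite /preimage/= -xz.
Qed.

(** A space [M] parametrized by [p : R -> M], with a section [q]: the circle
    with its universal covering, or a segment, for which only the parameters in
    [I = [0, 1]] matter. The parameters of a point are unique up to the integers
    that are periods of [p]. *)
Section parametrized_space.
Variables (R : realType) (M : topologicalType) (p : R -> M) (q : M -> R).
Variable I : set R.
Hypothesis M_hausdorff : hausdorff_space M.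
Hypothesis p_continuous : continuous p.
Hypothesis q01 : forall x, 0 <= q x <= 1.
Hypothesis I01 : forall t, 0 <= t <= 1 -> I t.
Hypothesis qK : cancel q p.
Hypothesis pK : forall t, I t -> exists2 n : int,
  q (p t) = t + n%:~R & forall s, p (s + n%:~R) = p s.

Lemma image_p : p @` `[0, 1] = [set: M].
Proof.
apply/seteqP; split => // x _; exists (q x); last exact: qK.
by rewrite /= in_itv/= q01.
Qed.

Lemma param_compact : compact [set: M].
Proof.
rewrite -image_p; apply: continuous_compact; last exact: segment_compact.
exact: continuous_subspaceT.
Qed.

Lemma descend_continuous (Y : topologicalType) (f : M -> Y) (g : R -> Y) :
  continuous g -> (forall t, 0 <= t <= 1 -> f (p t) = g t) -> continuous f.
Proof.
move=> cg fg; apply/continuous_closedP => K cK.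
have -> : f @^-1` K = p @` (`[0, 1] `&` g @^-1` K).
  apply/seteqP; split => [x Kx|_ [t [/= t01 Kt] <-]].
    exists (q x); last exact: qK.
    split; first by rewrite /= in_itv/= q01.
    by rewrite /preimage/= -fg ?qK ?q01.
  by rewrite /preimage/= fg//; move: t01; rewrite in_itv.
apply: compact_closed => //; apply: continuous_compact.
  exact: continuous_subspaceT.
apply: (subclosed_compact _ (@segment_compact R 0 1)); last exact: subIsetl.
apply: closedI; first exact: interval_closed.
by apply: closed_comp => // t _; exact: cg.
Qed.

Variable u : R -> R.
Hypothesis u_ge0 : forall x, 0 <= u x.
Hypothesis u_periodic : forall x, u (x + 1) = u x.
Hypothesis u_mass : mass u `[0, 1[ = 1%E.
Hypothesis u_dense : forall x y, x < y -> exists2 z, x < z < y & 0 < u z.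

Local Notation collapse := (collapse u_ge0 u_periodic u_mass u_dense).
Local Notation blow := (blow u_ge0 u_periodic u_mass u_dense).

Hypothesis collapse_I : forall t, I (collapse t) <-> I t.

(** The map of [M] induced by [collapse]. *)
Definition fold x : M := p (collapse (q x)).

Lemma fold_p t : I t -> fold (p t) = p (collapse t).
Proof. by move=> /pK[n qpt pn]; rewrite /fold qpt collapseDz pn. Qed.

Lemma fold_continuous : continuous fold.
Proof.
apply: (@descend_continuous _ _ (p \o collapse)) => [t|t /I01]; last exact: fold_p.
apply: continuous_comp; [exact: collapse_continuous|exact: p_continuous].
Qed.

Lemma fold_surj y : exists x, fold x = y.
Proof.
exists (p (center u (q y))); rewrite fold_p ?collapse_center ?qK//.
by apply/collapse_I; rewrite collapse_center; apply: I01; exact: q01.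
Qed.

Lemma fold_fiber y :
  fold @^-1` [set y] = p @` [set t | in_gap u (q y) t].
Proof.
apply/seteqP; split => [z /= zy|_ [t /= yt <-]].
  have Iz : I (collapse (q z)) by apply/collapse_I/I01/q01.
  have Iy : I (q y) by apply/I01/q01.
  have [n qn pn] := pK Iz; have [m qm pm] := pK Iy.
  have E : q y = collapse (q z) + (n - m)%:~R.
    by have := qm; rewrite qK -zy -/(fold z) /fold qn intrB; lra.
  exists (q z + (n - m)%:~R).
    by rewrite /= E -(collapseDz u_ge0 u_periodic u_mass u_dense); exact: collapse_gap.
  rewrite intrB addrA -pm subrK pn; exact: qK.
have It : I t.
  by apply/collapse_I; rewrite (collapseE _ _ _ _ yt); apply/I01/q01.
by rewrite /preimage/= fold_p// (collapseE _ _ _ _ yt) qK.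
Qed.

Lemma fold_connected (J : set M) : connected J -> connected (fold @^-1` J).
Proof.
apply: connected_preimage => //; [exact: param_compact|exact: fold_continuous|exact: fold_surj|].
move=> y; rewrite fold_fiber.
have -> : [set t | in_gap u (q y) t] =
    `[center u (q y) - half u (q y), center u (q y) + half u (q y)]%classic.
  apply/seteqP; split => t /=; rewrite in_itv/=.
    by move=> /in_gapP[-> ->].
  by move=> /andP[? ?]; apply/in_gapP.
apply: connected_continuous_connected; first exact: segment_connected.
exact: continuous_subspaceT.
Qed.

Variables (G : groupType) (rho : G -> M -> M) (sgn : G -> R) (F : G -> R -> R).
Hypothesis F_lift : forall g, lift (sgn g) (F g).
Hypothesis F_tame : forall g, tame u (F g).
Hypothesis F_I : forall g t, I t -> I (F g t).
Hypothesis F_p : forall g t, I t -> p (F g t) = rho g (p t).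
Hypothesis sgnM : forall g k, sgn (g * k)%g = sgn g * sgn k.
Hypothesis F_M : forall g k t, I t -> exists2 n : int,
  F (g * k)%g t = F g (F k t) + n%:~R & forall s, p (s + n%:~R) = p s.

(** The action on [M] induced by the maps [blow] of the lifts. *)
Definition blown g x : M := p (blow (sgn g) (F g) (q x)).

Lemma blown_p g t : I t -> blown g (p t) = p (blow (sgn g) (F g) t).
Proof.
move=> /pK[n qpt pn]; rewrite /blown qpt blowDz//.
case: (F_lift g) => -[] -> _ _ _; first by rewrite mul1r pn.
by rewrite mulN1r -[LHS]pn subrK.
Qed.

Lemma blow_I g t : I t -> I (blow (sgn g) (F g) t).
Proof. by move=> It; apply/collapse_I; rewrite collapse_blow//; apply/F_I/collapse_I. Qed.

Lemma blownM g k x : blown (g * k)%g x = blown g (blown k x).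
Proof.
have Ix : I (q x) by apply/I01/q01.
have [n Fn pn] := F_M g k (proj2 (collapse_I _) Ix).
rewrite /blown -/(blown g _) blown_p; last exact: blow_I.
rewrite blow_comp// -sgnM (@blow_ext _ _ _ _ _ _ _ (F g \o F k) _ _ n)//.
Qed.

Lemma sgn1 : sgn 1%g = 1.
Proof.
have := sgnM 1%g 1%g; rewrite mulg1; case: (F_lift 1%g) => -[] -> //.
by rewrite mulrNN mulr1.
Qed.

Lemma blown_continuous g : continuous (blown g).
Proof.
apply: (@descend_continuous _ _ (p \o blow (sgn g) (F g))) => [t|t /I01]; last exact: blown_p.
apply: continuous_comp; [exact: blow_continuous|exact: p_continuous].
Qed.

Hypothesis F_1 : forall t, I t -> exists2 n : int,
  F 1%g t = t + n%:~R & forall s, p (s + n%:~R) = p s.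

Lemma blown1 x : blown 1%g x = x.
Proof.
have Ix : I (q x) by apply/I01/q01.
have [n Fn pn] := F_1 (proj2 (collapse_I _) Ix).
rewrite /blown sgn1 (@blow_ext _ _ _ _ _ _ _ id _ _ n)// pn blow_id; exact: qK.
Qed.

Lemma blown_action : topological_action blown.
Proof.
split=> [g|g k]; last by apply/funext => x; exact: blownM.
exists (blown g^-1%g); split; [| |exact: blown_continuous|exact: blown_continuous];
  by move=> x; rewrite -blownM ?mulVg ?mulgV blown1.
Qed.

Lemma blown_blow_up : blow_up blown rho.
Proof.
exists fold; split.
- exact: fold_continuous.
- by move=> y _; have [x <-] := fold_surj y; exists x.
- exact: fold_connected.
move=> g; apply/funext => x /=; have Ix : I (q x) by apply/I01/q01.
rewrite /blown fold_p; last exact: blow_I.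
by rewrite collapse_blow// F_p//; apply/collapse_I.
Qed.

End parametrized_space.

Section fractional_part.
Variable R : realType.
Implicit Types t : R.

(** The fractional part. *)
Definition frac t : R := t - (Num.floor t)%:~R.

Lemma frac01 t : 0 <= frac t < 1.
Proof. by rewrite subr_ge0 floor_le_tmp ltrBlDl -intrD1 lt_succ_floor. Qed.

Lemma frac_uniq t (n : int) : n%:~R <= t < n%:~R + 1 -> frac t = t - n%:~R.
Proof. by move=> H; rewrite /frac (@floor_def _ _ n)// intrD. Qed.

Lemma frac_id t : 0 <= t < 1 -> frac t = t.
Proof. by move=> H; rewrite (@frac_uniq _ 0) ?subr0// add0r. Qed.

Lemma fracDz t (n : int) : frac (t + n%:~R) = frac t.
Proof.
have := frac01 t; rewrite {1 2}/frac => /andP[? ?].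
rewrite (@frac_uniq _ (Num.floor t + n)); last by rewrite intrD; lra.
by rewrite /frac intrD; ring.
Qed.

Lemma frac1 : frac 1 = 0.
Proof.
by have := fracDz 0 1; rewrite add0r mulr1z => ->; rewrite frac_id// lexx ltr01.
Qed.

(** A monotone bijection of [[0, 1[] with an interval of length 1, closed at the
    image of 0, extends to a lift. *)
Lemma lift_extend (sg : R) (k : R -> R) (c : R) : sg = 1 \/ sg = -1 ->
  (forall x y, 0 <= x -> x < y -> y < 1 -> k x < k y) ->
  (forall x, 0 <= x < 1 -> c <= k x < c + 1) ->
  (forall y, c <= y < c + 1 -> exists2 x, 0 <= x < 1 & k x = y) ->
  lift sg (fun t => sg * (k (frac t) + (Num.floor t)%:~R)).
Proof.
move=> sg1 kinc kc ksurj.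
have sgK : sg * sg = 1 by case: sg1 => ->; rewrite ?mulrNN mulr1.
split => // [x y xy|y|x].
- rewrite !mulrA !sgK !mul1r.
  have : Num.floor x <= Num.floor y by exact/le_floor/ltW.
  rewrite le_eqVlt => /predU1P[fxy|].
    rewrite fxy ltrD2r; have /andP[x0 _] := frac01 x; have /andP[_ y1] := frac01 y.
    by apply: kinc => //; rewrite /frac fxy ltrD2r.
  rewrite -lezD1 -(ler_int R) intrD => fxy.
  have /andP[_ ?] := kc _ (frac01 x); have /andP[? _] := kc _ (frac01 y); lra.
- pose z := sg * y; pose n := Num.floor (z - c).
  have /andP[n1 n2] := frac01 (z - c); rewrite /frac -/n in n1 n2.
  have [|x x01 kx] := ksurj (z - n%:~R); first by lra.
  exists (x + n%:~R); rewrite fracDz frac_id// kx.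
  have -> : Num.floor (x + n%:~R) = n.
    by apply/floor_def; rewrite intrD; lra.
  by rewrite subrK /z mulrA sgK mul1r.
- rewrite -[X in x + X]/(1%:~R) fracDz.
  have -> : Num.floor (x + 1%:~R) = Num.floor x + 1.
    by apply/floor_def; have := frac01 x; rewrite /frac !intrD; lra.
  by rewrite intrD; ring.
Qed.

End fractional_part.

Section rational_points.
Variable R : realType.

(** An enumeration of the rational points of the open unit interval; the numbers
    that do not code such a point are sent to [1 / 2]. *)
Definition rat01 (n : nat) : R :=
  let r := ratr (odflt 0 (choice.unpickle n : option rat)) in
  if 0 < r < 1 then r else 2^-1.

Lemma rat01_itv n : 0 < rat01 n < 1.
Proof.
rewrite /rat01; case: ifP => // _.
by rewrite invr_gt0 ltr0n/= invf_lt1// ltr1n.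
Qed.

Lemma rat01_dense (x y : R) : x < y ->
  exists n (k : int), x < rat01 n + k%:~R < y.
Proof.
move=> xy; have /andP[f1 f2] := frac01 x; pose m := Num.floor x.
rewrite /frac -/m in f1 f2.
have [|r] := @rat_in_itvoo R x (Num.min y (m%:~R + 1)).
  by rewrite lt_min xy/= -intrD1 lt_succ_floor.
rewrite in_itv/= lt_min => /andP[xr /andP[ry rm]].
exists (choice.pickle (r - m%:~R)), m.
rewrite /rat01 choice.pickleK/= rmorphB/= ratr_int.
by rewrite ifT ?subrK ?xr//; lra.
Qed.

End rational_points.

Lemma countable_enum (T : Type) (x0 : T) : countable [set: T] ->
  exists e : nat -> T, forall x, exists n, e n = x.
Proof.
move=> /countable_injP[f finj].
exists (fun n => if pselect (exists x, f x = n) is left ex then sval (cid ex) else x0).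
move=> x; exists (f x); case: pselect => [ex|[]]; last by exists x.
by apply: finj; rewrite ?in_setT//; exact: svalP (cid ex).
Qed.

Section blow_up_of_lifted_action.
Variables (R : realType) (M : topologicalType) (p : R -> M) (q : M -> R).
Variables (I : set R) (Ends : set M).
Hypothesis M_hausdorff : hausdorff_space M.
Hypothesis p_continuous : continuous p.
Hypothesis q01 : forall x, 0 <= q x <= 1.
Hypothesis I01 : forall t, 0 <= t <= 1 -> I t.
Hypothesis qK : cancel q p.
Hypothesis pK : forall t, I t -> exists2 n : int,
  q (p t) = t + n%:~R & forall s, p (s + n%:~R) = p s.

Variables (G : groupType) (rho : G -> M -> M) (sgn : G -> R) (F : G -> R -> R).
Hypothesis G_countable : countable [set: G].
Hypothesis rho1 : forall x, rho 1%g x = x.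
Hypothesis rhoM : forall g h x, rho (g * h)%g x = rho g (rho h x).
Hypothesis rho_subexp : subexponential_orbits R rho.
Hypothesis F_lift : forall g, lift (sgn g) (F g).
Hypothesis F_I : forall g t, I t -> I (F g t).
Hypothesis F_p : forall g t, I t -> p (F g t) = rho g (p t).
Hypothesis sgnM : forall g k, sgn (g * k)%g = sgn g * sgn k.
Hypothesis F_M : forall g k t, I t -> exists2 n : int,
  F (g * k)%g t = F g (F k t) + n%:~R & forall s, p (s + n%:~R) = p s.
Hypothesis F_1 : forall t, I t -> exists2 n : int,
  F 1%g t = t + n%:~R & forall s, p (s + n%:~R) = p s.

(** [Ends] is the set of the endpoints of [M]. They receive no weight, so that
    blowing up does not move them. *)
Hypothesis EndsM : forall g x, Ends (rho g x) -> Ends x.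
Hypothesis Ends_p : forall t, 0 < t < 1 -> ~ Ends (p t).
Hypothesis frac_p : forall t, I t ->
  p (frac t) = p t \/ Ends (p t) /\ Ends (p (frac t)).
Hypothesis I_Ends : I = setT \/ I = `[0, 1]%classic /\ Ends (p 0).

(** The weights on the orbits of the rational points, with two-sided control of
    the ratios. *)
Lemma exists_weight : exists w : M -> R,
  [/\ forall x, 0 <= w x, forall n, 0 < w (p (rat01 R n)),
      forall x, Ends x -> w x = 0, (\esum_(x in [set: M]) (w x)%:E < +oo)%E &
      forall g, (forall x, 0 < w x <-> 0 < w (rho g x)) /\
      (forall b : R, 0 < b ->
        finite_set [set x | b * w x < `|w (rho g x) - w x|])].
Proof.
have [e e_surj] := countable_enum (1%g : G) G_countable.
pose d n := p (rat01 R n); pose w := weight e d rho_subexp.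
have w0 x : 0 <= w x by exact: weight_ge0.
have wP x : 0 < w x <-> exists g i, x = rho g (d i) by exact: weight_gt0P.
exists w; split => //.
- by move=> n; apply/wP; exists 1%g, n; rewrite rho1.
- move=> x Ex; apply/eqP; rewrite eq_le w0 andbT leNgt; apply/negP => /wP[g [i xE]].
  by move: Ex; rewrite xE => /EndsM; apply: Ends_p; exact: rat01_itv.
- exact: weight_summable.
move=> g; split=> [x|b b0].
  split=> /wP[k [i E]]; apply/wP; first by exists (g * k)%g, i; rewrite rhoM -E.
  by exists (g^-1 * k)%g, i; rewrite rhoM -E -rhoM mulVg rho1.
(* [c] is chosen so that [1 - c] is the inverse of [1 + b]. *)
pose c := b / (1 + b); have c0 : 0 < c by rewrite divr_gt0// addr_gt0.
have fin1 := weight_ratio d rhoM rho_subexp e_surj g b0.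
have fin2 := weight_ratio d rhoM rho_subexp e_surj g^-1%g c0.
have fin := conj fin1 (finite_image (rho g^-1%g) fin2).
rewrite -finite_setU in fin; apply: sub_finite_set fin => x /=; rewrite -/w;
have [gx|gx] := leP (w x) (w (rho g x)).
  rewrite ger0_norm ?subr_ge0// => H; right; exists (rho g x).
    rewrite /= -rhoM mulVg rho1 -/w.
    have -> : 1 - c = (1 + b)^-1 by rewrite /c; field; rewrite gt_eqF// addr_gt0.
    by rewrite ltr_pdivlMl ?addr_gt0//; lra.
  by rewrite -rhoM mulVg rho1.
by rewrite ltr0_norm ?subr_lt0// => H; left; rewrite /=; lra.
Qed.

(** The weight transported to the line and normalized. *)
Lemma exists_line_weight : exists u : R -> R,
  [/\ forall x, 0 <= u x, forall x, u (x + 1) = u x, mass u `[0, 1[ = 1%E,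
      forall x y, x < y -> exists2 z, x < z < y & 0 < u z &
      (Ends (p 0) -> u 0 = 0) /\ forall g, tame u (F g)].
Proof.
have [w [w0 wr wE wsum wG]] := exists_weight.
pose v t := w (p (frac t)).
have v0 t : 0 <= v t by exact: w0.
have frac_pK t : 0 <= t < 1 -> frac (q (p t)) = t.
  move=> t01; have [|n -> _] := @pK t; first by apply/I01; lra.
  by rewrite fracDz frac_id.
have vz t (n : int) : v (t + n%:~R) = v t by rewrite /v fracDz.
have mv_fin : mass v `[0, 1[ \is a fin_num.
  rewrite ge0_fin_numE; last exact: mass_ge0.
  apply: le_lt_trans wsum; pose P := p @` `[0, 1[.
  apply: (@le_trans _ _ (\esum_(x in P) (w x)%:E)%E).
    rewrite esum_image; last first.
      by move=> x y; rewrite !inE/= !in_itv/= => /frac_pK {2}<- /frac_pK {2}<- ->.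
    by apply: le_esum => t; rewrite /= in_itv/= => t01; rewrite /v frac_id.
  rewrite [leLHS]esum_mkcond; apply: le_esum => x _.
  by case: ifP; rewrite lee_fin.
pose W := fine (mass v `[0, 1[).
have WE : mass v `[0, 1[ = W%:E by rewrite fineK.
have W0 : 0 < W.
  have r01 := rat01_itv R 0; rewrite -lte_fin -WE.
  apply: (@lt_le_trans _ _ (v (rat01 R 0))%:E).
    by rewrite lte_fin /v frac_id//; lra.
  rewrite -(mass_set1 v0); apply: mass_sub => // t /= ->.
  by rewrite in_itv/=; lra.
exists (fun t => v t / W); split.
- by move=> t; rewrite divr_ge0// ltW.
- by move=> t; rewrite -[X in t + X]/(1%:~R) vz.
- apply/eqP; rewrite eq_le; apply/andP; split.
    have := @esum_le_scale R R `[0, 1[%classic (fun t => v t / W) v W^-1.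
    rewrite -/(mass v _) WE -EFinM mulVf ?gt_eqF//; apply => //.
      by rewrite invr_ge0 ltW.
    by move=> t _; rewrite mulrC.
  have := @esum_le_scale R R `[0, 1[%classic v (fun t => v t / W) W.
  rewrite -!/(mass _ _) WE => H.
  rewrite -(@lee_pmul2l _ W%:E)//= mule1; apply: H; first exact: ltW.
    by move=> t _; rewrite divr_ge0// ltW.
  by move=> t _; rewrite mulrC divfK// gt_eqF.
- move=> x y /rat01_dense[n [k H]]; exists (rat01 R n + k%:~R) => //.
  rewrite divr_gt0// vz /v frac_id//; have := rat01_itv R n; lra.
split=> [E0|g].
  by rewrite /v frac_id ?lexx ?ltr01// wE ?mul0r.
have vF x : v (F g x) = w (rho g (p (frac x))).
  have -> : F g x = F g (frac x) + sgn g * (Num.floor x)%:~R.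
    by rewrite -(liftDz (F_lift g)) subrK.
  have [n ->] : exists n : int, sgn g * (Num.floor x)%:~R = n%:~R.
    by case: (F_lift g) => sg1 _ _ _; exact: sign_mul_int.
  have If : I (frac x) by apply: I01; have := frac01 x; lra.
  rewrite vz -F_p//; have [E|[E1 E2]] := frac_p (F_I g If); first by rewrite /v E.
  by rewrite /v !wE.
split=> [x|e e0].
  rewrite /half /same_gap vF /v; set y := p (frac x).
  have [y0|y0] := ltP 0 (w y).
    have gy0 : 0 < w (rho g y) by exact: (proj1 ((wG g).1 y)).
    by rewrite !divr_gt0.
  have -> : w y = 0 by apply/eqP; rewrite eq_le y0 w0.
  have -> : w (rho g y) = 0.
    apply/eqP; rewrite eq_le w0 andbT leNgt; apply/negP.
    by move=> /(proj2 ((wG g).1 y)); rewrite ltNge y0.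
  by rewrite !mul0r eqxx orbT.
apply: sub_finite_set (finite_image (fun y => frac (q y)) ((wG g).2 e e0)).
move=> x [x01 H] /=; exists (p x); last exact: frac_pK.
move: H; rewrite /= vF /v frac_id// -mulrBl normrM mulrA.
by rewrite (ger0_norm (_ : 0 <= W^-1)) ?ltr_pM2r ?invr_ge0 ?invr_gt0// ltW.
Qed.

(** The blow-up [rho'] of [rho], where [rho' g] is induced by a map [B g] of the
    line with continuous derivative [D g]. *)
Theorem blow_up_exists : exists (rho' : G -> M -> M) (B D : G -> R -> R),
  [/\ topological_action rho', blow_up rho' rho,
      forall g t, I t -> I (B g t) /\ rho' g (p t) = p (B g t),
      forall g (t : R), is_derive t 1 (B g) (D g t) & forall g, continuous (D g)].
Proof.
have [u [u0 u1 um ud [uE uF]]] := exists_line_weight.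
have coll t : I (collapse u0 u1 um ud t) <-> I t.
  case: I_Ends => [->//|[-> E0]]; rewrite /= !in_itv/=.
  have h0 : half u 0 = 0 by rewrite /half uE ?mul0r.
  have h1 : half u 1 = 0 by have := half_periodicz u1 0 1; rewrite add0r mulr1z => ->.
  have c0 : center u 0 = 0 := center0 u.
  have c1 : center u 1 = 1.
    by have := centerDz u0 u1 um 0 1; rewrite !add0r !mulr1z => ->; rewrite c0 add0r.
  set x := collapse _ _ _ _ t; have xt : in_gap u x t by exact: collapse_gap.
  have /in_gapP[xt1 xt2] := xt; split=> /andP[l r]; apply/andP; split.
  - have := l; rewrite le_eqVlt => /predU1P[x0|/(gaps_disjoint u0 u1 um ud)].
      by rewrite -x0 h0 c0 in xt1; lra.
    by rewrite c0 h0; lra.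
  - have := r; rewrite le_eqVlt => /predU1P[x0|/(gaps_disjoint u0 u1 um ud)].
      by rewrite x0 h1 c1 in xt2; lra.
    by rewrite c1 h1; lra.
  - rewrite leNgt; apply/negP => /(gaps_disjoint u0 u1 um ud).
    by rewrite c0 h0; lra.
  rewrite leNgt; apply/negP => /(gaps_disjoint u0 u1 um ud).
  by rewrite c1 h1; lra.
pose B g := blow u0 u1 um ud (sgn g) (F g).
exists (blown p q u0 u1 um ud sgn F), B, (fun g t => sgn g * speed u0 u1 um ud (F g) t).
split.
- exact: (blown_action M_hausdorff p_continuous q01 I01 qK pK coll F_lift uF F_I
    sgnM F_M F_1).
- exact: (blown_blow_up M_hausdorff p_continuous q01 I01 qK pK coll F_lift uF F_I
    F_p).
- move=> g t It; split; first exact: (blow_I coll F_lift uF F_I).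
  exact: (blown_p pK u0 u1 um ud F_lift).
- by move=> g t; exact: (blow_is_derive u0 u1 um ud (F_lift g) (uF g)).
move=> g t; apply: cvgM; first exact: cvg_cst.
exact: (speed_continuous (F_lift g) (uF g)).
Qed.

End blow_up_of_lifted_action.

(** * Lifts and actions *)

Section lifts.
Variable R : realType.
Implicit Types (F : R -> R) (sg : R).

Lemma lift_comp sg1 F1 sg2 F2 :
  lift sg1 F1 -> lift sg2 F2 -> lift (sg1 * sg2) (F1 \o F2).
Proof.
move=> L1 L2; have [s1 i1 o1 p1] := L1; have [s2 i2 o2 p2] := L2; split.
- by case: s1 s2 => -> [->|->]; rewrite ?mulrNN ?mulr1 ?mulrN1 ?mul1r;
    [left|right|right|left].
- move=> x y /i2; case: s2 => ->; first by rewrite !mul1r mulr1 => /i1.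
  by rewrite !mulN1r ltrN2 mulrN1 !mulNr ltrN2 => /i1.
- by move=> y; have [x <-] := o1 y; have [z <-] := o2 x; exists z.
move=> x /=; rewrite p2; case: s2 => ->; first by rewrite p1 mulr1.
by have := liftDz L1 (F2 x) (-1); rewrite mulrNz mulr1z.
Qed.

Lemma lift_reflect F c : lift 1 F -> lift (-1) (fun t => c - F t).
Proof.
move=> [_ inc surj F1]; split; first by right.
- by move=> x y /inc; rewrite !mul1r !mulN1r; lra.
- by move=> y; have [x xy] := surj (c - y); exists x; rewrite xy; ring.
- by move=> x; rewrite F1; ring.
Qed.

(** The sign of a lift is determined by the lift modulo integers. *)
Lemma lift_sign sg1 F1 sg2 F2 : lift sg1 F1 -> lift sg2 F2 ->
  (forall t, 0 <= t <= 1 -> exists n : int, F1 t = F2 t + n%:~R) -> sg1 = sg2.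
Proof.
move=> [s1 i1 _ p1] [s2 i2 _ p2] H.
(* If the signs differ, [e] is increasing with integer values on [[0, 1]], but
   it only increases by 2. *)
pose e t := sg1 * F1 t + sg2 * F2 t.
have [//|ne] := eqVneq sg1 sg2.
have sE : sg2 = - sg1.
  by case: s1 s2 ne => -> [->|->]; rewrite ?eqxx// opprK.
have eZ t : 0 <= t <= 1 -> exists n : int, e t = n%:~R.
  move=> /H[n E]; rewrite /e E sE; case: s1 => ->; first by exists n; ring.
  by exists (- n)%R; rewrite mulrNz; ring.
have einc s t : s < t -> e s < e t.
  by move=> st; rewrite /e ltrD ?i1 ?i2.
have step s t : 0 <= s -> s < t -> t <= 1 -> e s + 1 <= e t.
  move=> s0 st t1; have := einc s t st.
  have [|m ->] := eZ s; first by lra.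
  have [|n ->] := eZ t; first by lra.
  by rewrite ltr_int -lezD1 -(ler_int R) intrD.
have e1 : e 1 = e 0 + 2.
  have := p1 0; have := p2 0; rewrite /e !add0r => -> ->.
  have : sg1 * sg1 = 1 by case: s1 => ->; rewrite ?mulrNN mulr1.
  have : sg2 * sg2 = 1 by case: s2 => ->; rewrite ?mulrNN mulr1.
  lra.
have h1 : e 0 + 1 <= e 3^-1 by apply: step; lra.
have h2 : e 3^-1 + 1 <= e (2 / 3) by apply: step; lra.
have h3 : e (2 / 3) + 1 <= e 1 by apply: step; lra.
lra.
Qed.

End lifts.

Lemma injective_hausdorff (X Y : topologicalType) (f : X -> Y) :
  hausdorff_space Y -> continuous f -> injective f -> hausdorff_space X.
Proof.
move=> hY cf fI x y xy; apply/fI/hY => A B xA yB.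
have [z [? ?]] := xy _ _ (cf x _ xA) (cf y _ yB).
by exists (f z).
Qed.

Lemma action_one (G : groupType) (X : topologicalType) (rho : G -> X -> X) :
  topological_action rho -> forall x, rho 1%g x = x.
Proof.
move=> [hom mul] x; have [g [gK _ _ _]] := hom 1%g.
have E : rho 1%g (rho 1%g x) = rho 1%g x.
  by have := congr1 (fun f => f x) (mul 1%g 1%g); rewrite mulg1.
by rewrite -[LHS]gK E gK.
Qed.

Lemma action_mul (G : groupType) (X : topologicalType) (rho : G -> X -> X) :
  topological_action rho -> forall g k x, rho (g * k)%g x = rho g (rho k x).
Proof. by move=> [_ mul] g k x; rewrite mul. Qed.

Section blow_up_of_action.
Variables (R : realType) (M : topologicalType) (p : R -> M) (q : M -> R).
Variables (I : set R) (Ends : set M).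
Hypothesis M_hausdorff : hausdorff_space M.
Hypothesis p_continuous : continuous p.
Hypothesis q01 : forall x, 0 <= q x <= 1.
Hypothesis I01 : forall t, 0 <= t <= 1 -> I t.
Hypothesis qK : cancel q p.
Hypothesis pK : forall t, I t -> exists2 n : int,
  q (p t) = t + n%:~R & forall s, p (s + n%:~R) = p s.
Hypothesis Ends_p : forall t, 0 < t < 1 -> ~ Ends (p t).
Hypothesis frac_p : forall t, I t ->
  p (frac t) = p t \/ Ends (p t) /\ Ends (p (frac t)).
Hypothesis I_Ends : I = setT \/ I = `[0, 1]%classic /\ Ends (p 0).
Hypothesis exists_lift : forall f : M -> M, homeomorphism f ->
  (exists sg F, lift sg F /\ forall t, I t -> I (F t) /\ p (F t) = f (p t)) /\
  (forall x, Ends (f x) -> Ends x).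

(** Choosing one lift for every group element is enough: the lifts of a product
    and the products of the lifts agree up to periods of [p]. *)
Theorem blow_up_of_action (G : groupType) (rho : G -> M -> M) :
  countable [set: G] -> topological_action rho -> subexponential_orbits R rho ->
  exists (rho' : G -> M -> M) (B D : G -> R -> R),
  [/\ topological_action rho', blow_up rho' rho,
      forall g t, I t -> I (B g t) /\ rho' g (p t) = p (B g t),
      forall g (t : R), is_derive t 1 (B g) (D g t) & forall g, continuous (D g)].
Proof.
move=> cG act subexp.
have rho1 := action_one act; have rhoM := action_mul act.
have /choice[sgn] := fun g => (exists_lift (act.1 g)).1.
move=> /choice[F FP].
have F_lift g : lift (sgn g) (F g) by have [] := FP g.
have F_I g t : I t -> I (F g t) by move=> It; have [_ /(_ t It)[]] := FP g.
have F_p g t : I t -> p (F g t) = rho g (p t).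
  by move=> It; have [_ /(_ t It)[]] := FP g.
have same s t : I s -> I t -> p s = p t -> exists2 n : int,
    s = t + n%:~R & forall r, p (r + n%:~R) = p r.
  move=> Is It pst; have [m qm pm] := pK Is; have [n qn pn] := pK It.
  have E : s = t + (n - m)%:~R.
    by have := qm; rewrite pst qn intrB; lra.
  by exists (n - m) => // r; rewrite intrB addrA -pm subrK pn.
have F_M g k t : I t -> exists2 n : int,
    F (g * k)%g t = F g (F k t) + n%:~R & forall s, p (s + n%:~R) = p s.
  move=> It; apply: same; [exact: F_I|exact/F_I/F_I|].
  by rewrite !F_p ?rhoM//; exact: F_I.
have F_1 t : I t -> exists2 n : int,
    F 1%g t = t + n%:~R & forall s, p (s + n%:~R) = p s.
  by move=> It; apply: same => //; [exact: F_I|rewrite F_p].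
have sgnM g k : sgn (g * k)%g = sgn g * sgn k.
  apply: (lift_sign (F_lift _) (lift_comp (F_lift g) (F_lift k))) => t t01.
  by have [n ? _] := F_M g k t (I01 t01); exists n.
have EndsM g x : Ends (rho g x) -> Ends x by exact: (exists_lift (act.1 g)).2.
exact: (blow_up_exists M_hausdorff p_continuous q01 I01 qK pK cG rho1 rhoM
  subexp F_lift F_I F_p sgnM F_M F_1 EndsM Ends_p frac_p I_Ends).
Qed.

End blow_up_of_action.

(** * Actions on an interval *)

Lemma is_derive_estimate (R : realType) (B : R -> R) (t D e : R) :
  is_derive t 1 B D -> 0 < e -> exists2 d, 0 < d &
    forall s, s != t -> `|s - t| < d -> `|D - (B s - B t) / (s - t)| <= e.
Proof.
move=> [dB BD] e0; have : h^-1 *: (B (h *: 1 + t) - B t) @[h --> 0^'] --> D.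
  by rewrite -BD.
move=> /cvgrPdist_le/(_ e e0)/nbhs_ballP[d /= d0 H].
exists d => // s st sd; have := H (s - t); rewrite /ball/= sub0r normrN => /(_ sd).
rewrite subr_eq0 => /(_ st); rewrite [_ *: 1]mulr1 subrK.
by rewrite [_ *: _]mulrC.
Qed.

Section interval.
Variables (R : realType) (a b : R).
Hypothesis ab : a < b.
Local Notation seg := (set_type [set` `[a, b]]).
Implicit Types (x : seg) (t : R).

Let ba_gt0 : 0 < b - a. Proof. by rewrite subr_gt0. Qed.

(** The projection of the line to [[0, 1]]. *)
Definition clamp t : R := Num.min 1 (Num.max 0 t).

Lemma clamp01 t : 0 <= clamp t <= 1.
Proof.
rewrite /clamp le_min ge_min lexx ler01/= andbT.
by rewrite le_max lexx.
Qed.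

Lemma clamp_id t : 0 <= t <= 1 -> clamp t = t.
Proof. by move=> /andP[t0 t1]; rewrite /clamp max_r// min_r. Qed.

Lemma seg_point_subproof t : a + (b - a) * clamp t \in [set` `[a, b]].
Proof.
rewrite inE/= in_itv/=; have /andP[c0 c1] := clamp01 t.
have := mulr_ge0 (ltW ba_gt0) c0.
have : (b - a) * clamp t <= b - a by rewrite ler_piMr// ltW.
by move=> ? ?; apply/andP; split; lra.
Qed.

(** The parametrization of the segment, constant outside [[0, 1]]. *)
Definition seg_point t : seg := exist _ (a + (b - a) * clamp t) (seg_point_subproof t).

Definition seg_coord x : R := (\val x - a) / (b - a).

Lemma val_seg_point t : \val (seg_point t) = a + (b - a) * clamp t.
Proof. by []. Qed.

Lemma seg_coord01 x : 0 <= seg_coord x <= 1.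
Proof.
have : \val x \in [set` `[a, b]] by exact: valP.
rewrite inE/= in_itv/= /seg_coord => /andP[ax xb].
apply/andP; split; first by rewrite divr_ge0 ?subr_ge0// ltW.
by rewrite ler_pdivrMr// mul1r lerD2r.
Qed.

Lemma seg_coordK : cancel seg_coord seg_point.
Proof.
move=> x; apply/val_inj; rewrite /= clamp_id ?seg_coord01//.
by rewrite /seg_coord mulrC divfK ?gt_eqF// addrC subrK.
Qed.

Lemma seg_pointK t : 0 <= t <= 1 -> seg_coord (seg_point t) = t.
Proof.
move=> t01; rewrite /seg_coord val_seg_point clamp_id// addrC addKr.
by rewrite mulrC mulKf// gt_eqF.
Qed.

Lemma clamp_continuous : continuous clamp.
Proof.
move=> t; apply: (@continuous_min R R (cst 1) (fun s => Num.max 0 s) t).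
  exact: cvg_cst.
by apply: (@continuous_max R R (cst 0) id t); [exact: cvg_cst|exact: cvg_id].
Qed.

Lemma val_seg_continuous : continuous (fun x => \val x : R).
Proof. exact: initial_continuous. Qed.

Lemma seg_point_continuous : continuous seg_point.
Proof.
apply: continuous_comp_initial => t; apply: cvgD; first exact: cvg_cst.
apply: cvgM; first exact: cvg_cst.
exact: clamp_continuous.
Qed.

Lemma seg_coord_continuous : continuous seg_coord.
Proof.
move=> x; apply: (@continuous_comp _ _ _ (fun y : seg => \val y)
  (fun v => (v - a) / (b - a))); first exact: val_seg_continuous.
apply: cvgM; last exact: cvg_cst.
by apply: cvgB; [exact: cvg_id|exact: cvg_cst].
Qed.

Lemma seg_hausdorff : hausdorff_space seg.
Proof.
apply: (injective_hausdorff (@Rhausdorff R) val_seg_continuous).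
exact: val_inj.
Qed.

(** Increasing bijections of the unit interval extend to lifts. *)
Lemma increasing_lift (k : R -> R) :
  (forall s t, 0 <= s -> s < t -> t <= 1 -> k s < k t) ->
  (forall t, 0 <= t <= 1 -> 0 <= k t <= 1) ->
  (forall y, 0 <= y <= 1 -> exists2 t, 0 <= t <= 1 & k t = y) ->
  exists2 F, lift 1 F & forall t, 0 <= t <= 1 -> F t = k t.
Proof.
move=> kinc k01 ksurj.
have [|t0 /andP[t00 t01] kt0] := ksurj 0; first by lra.
have k0 : k 0 = 0.
  move: t00; rewrite le_eqVlt => /predU1P[t0E|t00'].
    by rewrite [X in k X]t0E.
  by have := kinc 0 t0 (lexx _) t00' t01; have := k01 0; lra.
have [|t1 /andP[t10 t11] kt1] := ksurj 1; first by lra.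
have k1 : k 1 = 1.
  move: t11; rewrite le_eqVlt => /predU1P[t1E|t11'].
    by rewrite -[X in k X]t1E.
  by have := kinc t1 1 t10 t11' (lexx _); have := k01 1; lra.
exists (fun t => 1 * (k (frac t) + (Num.floor t)%:~R)).
  apply: (@lift_extend _ _ _ 0); first by left.
  - by move=> x y x0 xy y1; apply: kinc => //; exact: ltW.
  - move=> x /andP[x0 x1]; have := k01 x; have := kinc x 1 x0 x1 (lexx _); lra.
  move=> y y01; have [|t /andP[t0' t1'] kt] := ksurj y; first by lra.
  exists t => //; rewrite t0'/=; move: t1'; rewrite le_eqVlt => /predU1P[tE|//].
  by move: kt; rewrite tE k1; lra.
move=> t /andP[t0' t1']; rewrite mul1r; move: t1'.
rewrite le_eqVlt => /predU1P[->|t1'].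
  by rewrite k1 floor1 frac1 k0 add0r.
by rewrite frac_id ?t0'// (@floor_def _ _ 0) ?addr0// t0'.
Qed.

Definition seg_ends : set seg := [set x | seg_coord x = 0 \/ seg_coord x = 1].

Lemma seg_lift (f : seg -> seg) : homeomorphism f ->
  (exists sg F, lift sg F /\ forall t, `[0, 1]%classic t ->
     `[0, 1]%classic (F t) /\ seg_point (F t) = f (seg_point t)) /\
  (forall x, seg_ends (f x) -> seg_ends x).
Proof.
move=> [g [fK gK cf cg]]; pose k t := seg_coord (f (seg_point t)).
have k01 t : 0 <= k t <= 1 by exact: seg_coord01.
have ck : continuous k.
  move=> t; apply: (@continuous_comp _ _ _ (f \o seg_point) seg_coord).
    by apply: continuous_comp; [exact: seg_point_continuous|exact: cf].
  exact: seg_coord_continuous.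
have kinj : {in `[0, 1] &, injective k}.
  move=> s t; rewrite !in_itv/= => s01 t01 /(can_inj seg_coordK)/(can_inj fK) st.
  by rewrite -(seg_pointK s01) st seg_pointK.
have ksurj y : 0 <= y <= 1 -> exists2 t, 0 <= t <= 1 & k t = y.
  move=> y01; exists (seg_coord (g (seg_point y))); first exact: seg_coord01.
  by rewrite /k seg_coordK gK seg_pointK.
have [sg [F [F_lift Fk]]] : exists sg F, lift sg F /\
    forall t, 0 <= t <= 1 -> F t = k t.
  have [kinc|kdec] := itv_continuous_inj_mono (continuous_subspaceT ck) kinj.
    have [F F1 Fk] : exists2 F, lift 1 F & forall t, 0 <= t <= 1 -> F t = k t.
      apply: increasing_lift => // s t s0 st t1.
      by apply: kinc => //; rewrite in_itv/=; lra.
    by exists 1, F.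
  have [F F1 Fk] : exists2 F, lift 1 F &
      forall t, 0 <= t <= 1 -> F t = 1 - k t.
    apply: increasing_lift => [s t s0 st t1|t _|y y01].
    - by rewrite ltrD2l ltrN2; apply: kdec => //; rewrite in_itv/=; lra.
    - by have := k01 t; lra.
    - have [|t t01 kt] := ksurj (1 - y); first by lra.
      by exists t => //; rewrite kt; ring.
  exists (-1), (fun t => 1 - F t); split; first exact: lift_reflect.
  by move=> t t01; rewrite Fk//; ring.
split.
  exists sg, F; split => // t; rewrite /= in_itv/= => t01.
  by rewrite Fk// in_itv/= k01; split => //; rewrite /k seg_coordK.
move=> x; rewrite /seg_ends/=; set t := seg_coord x => fx.
have E : seg_coord (f x) = F t by rewrite Fk ?seg_coord01// /k /t seg_coordK.
rewrite E in fx; apply: contrapT => nt.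
have [sg1 inc _ F1] := F_lift.
have /andP[t0 t1] : 0 < t < 1.
  have /andP[t0 t1] := seg_coord01 x; rewrite -/t in t0 t1.
  by rewrite !lt_neqAle t0 t1 !andbT; apply/andP; split; apply/eqP => tE;
    apply: nt; [left|right].
have := inc 0 t t0; have := inc t 1 t1.
have := k01 0; rewrite -Fk ?lexx ?ler01//.
have := k01 1; rewrite -Fk ?lexx ?ler01//.
by case: sg1 => ->; rewrite ?mul1r ?mulN1r; case: fx => ->; lra.
Qed.

Theorem interval_blow_up (G : groupType) (rho : G -> seg -> seg) :
  countable [set: G] -> topological_action rho -> subexponential_orbits R rho ->
  exists rho' : G -> seg -> seg, [/\ topological_action rho',
    forall g, interval_C1 (rho' g) & blow_up rho' rho].
Proof.
move=> cG act subexp.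
have I01 t : 0 <= t <= 1 -> `[0, 1]%classic t by rewrite /= in_itv.
have pK t : `[0, 1]%classic t -> exists2 n : int,
    seg_coord (seg_point t) = t + n%:~R &
    forall s, seg_point (s + n%:~R) = seg_point s.
  rewrite /= in_itv/= => t01; exists 0 => [|s]; rewrite ?addr0//.
  exact: seg_pointK.
have Ends_p t : 0 < t < 1 -> ~ seg_ends (seg_point t).
  by move=> t01; rewrite /seg_ends/= seg_pointK; lra.
have E0 : seg_ends (seg_point 0) by left; rewrite seg_pointK// lexx ler01.
have frac_p t : `[0, 1]%classic t -> seg_point (frac t) = seg_point t \/
    seg_ends (seg_point t) /\ seg_ends (seg_point (frac t)).
  rewrite /= in_itv/= => /andP[t0]; rewrite le_eqVlt => /predU1P[->|t1].
    right; rewrite frac1; split => //.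
    by right; rewrite seg_pointK// lexx ler01.
  by left; rewrite frac_id// t0.
have [rho' [B [D [act' bu BI BD Dc]]]] := blow_up_of_action seg_hausdorff
  seg_point_continuous seg_coord01 I01 seg_coordK pK Ends_p frac_p
  (or_intror (conj erefl E0)) seg_lift cG act subexp.
exists rho'; split => // g.
have val_rho x : \val (rho' g x) = a + (b - a) * B g (seg_coord x).
  have [+ E] := BI g _ (I01 _ (seg_coord01 x)); rewrite seg_coordK in E.
  by rewrite E /= in_itv/= => /clamp_id ->.
exists (D g \o seg_coord).
  move=> x; apply: continuous_comp; last exact: Dc.
  exact: seg_coord_continuous.
move=> x; apply/cvgrPdist_le => e e0; set t := seg_coord x.
have [d d0 H] := is_derive_estimate (BD g t) e0.
have := @seg_coord_continuous x => /cvgrPdist_lt/(_ d d0) Hd.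
apply: filterS Hd => y xy yx; rewrite !val_rho -/t /=.
set s := seg_coord y in xy *.
have yE : \val y = a + (b - a) * s by rewrite /s /seg_coord; field; rewrite gt_eqF.
have xE : \val x = a + (b - a) * t by rewrite /t /seg_coord; field; rewrite gt_eqF.
have st : s != t.
  by apply: contra_neq yx => st; apply/val_inj; rewrite yE xE st.
rewrite distrC in xy; have := H s st xy; rewrite yE xE.
have E (u v : R) : a + (b - a) * u - (a + (b - a) * v) = (b - a) * (u - v).
  by ring.
by rewrite !E -mulf_div divff ?gt_eqF// mul1r.
Qed.

End interval.

(** * Actions on the circle *)

Section circle.
Variable R : realType.
Local Notation circ := (set_type (@circle_set R)).
Implicit Types (z : circ) (t : R).

Let tau : R := pi *+ 2.
Let tau_gt0 : 0 < tau. Proof. by rewrite mulrn_wgt0 ?pi_gt0// pmulrn_lgt0 ?pi_gt0. Qed.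

(** The covering of the circle, normalized to have period 1. *)
Definition turn t : circ := circle_point (tau * t).

Lemma val_turn t : \val (turn t) = (cos (tau * t), sin (tau * t)).
Proof. by []. Qed.

Lemma turnD1 t : turn (t + 1) = turn t.
Proof. by apply/val_inj; rewrite !val_turn mulrDr mulr1 cosD2pi sinD2pi. Qed.

Lemma turnDz t (n : int) : turn (t + n%:~R) = turn t.
Proof. exact: (periodic_int turnD1). Qed.

Lemma turn_frac t : turn (frac t) = turn t.
Proof. by rewrite -(turnDz (frac t) (Num.floor t)) subrK. Qed.

Lemma cos_tau_eq1 t : 0 <= t < 1 -> cos (tau * t) = 1 -> t = 0.
Proof.
move=> /andP[t0 t1]; rewrite /tau mulrnAl cos_mulr2n => c.
move: t0; rewrite le_eqVlt => /predU1P[->//|t0].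
have : 0 < sin (pi * t).
  by apply: sin_gt0_pi; rewrite mulr_gt0 ?pi_gt0//= gtr_pMr ?pi_gt0.
have := cos2Dsin2 (pi * t) => cs s0.
have : 0 < sin (pi * t) ^+ 2 by rewrite exprn_gt0.
move: c; rewrite mulr2n; lra.
Qed.

Lemma turn_eq s t : turn s = turn t -> exists n : int, s = t + n%:~R.
Proof.
move=> /(congr1 val); rewrite !val_turn => -[c1 c2].
exists (Num.floor (s - t)); suff : frac (s - t) = 0.
  by rewrite /frac; lra.
apply: cos_tau_eq1; first exact: frac01.
have -> : cos (tau * frac (s - t)) = cos (tau * (s - t)).
  by have /(congr1 val) := turn_frac (s - t); rewrite !val_turn => -[].
by rewrite mulrBr cosB c1 c2 -!expr2 cos2Dsin2.
Qed.

Lemma turn_surj z : exists t, turn t = z.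
Proof.
case: z => -[x y] H; have := H; rewrite inE /circle_set/= => xy.
have x1 : -1 <= x <= 1.
  have := sqr_ge0 y; have := sqr_ge0 (x - 1); have := sqr_ge0 (x + 1) => ? ? ?.
  rewrite -ler_norml -(@ler_pXn2r _ 2)// ?nnegrE// expr1n real_normK ?num_real//.
  by lra.
have cx : cos (acos x) = x by apply: acosK; rewrite in_itv.
have sx : sin (acos x) = `|y|.
  by rewrite sin_acos// (_ : 1 - x ^+ 2 = y ^+ 2) ?sqrtr_sqr//; lra.
have t0 : tau != 0 by rewrite gt_eqF.
have [y0|y0] := leP 0 y.
  exists (acos x / tau); apply/val_inj; rewrite val_turn mulrC divfK// cx sx.
  by rewrite ger0_norm.
exists (- acos x / tau); apply/val_inj; rewrite val_turn mulrC divfK// cosN sinN.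
by rewrite cx sx ltr0_norm// opprK.
Qed.

(** The parameter of a point of the circle in [[0, 1[]. *)
Definition angle z : R := frac (sval (cid (turn_surj z))).

Lemma angleK : cancel angle turn.
Proof. by move=> z; rewrite /angle turn_frac; case: cid. Qed.

Lemma angle01 z : 0 <= angle z < 1. Proof. exact: frac01. Qed.

Lemma turnK t : exists n : int, angle (turn t) = t + n%:~R.
Proof. by apply: turn_eq; rewrite angleK. Qed.

Lemma turn_continuous : continuous turn.
Proof.
apply: continuous_comp_initial => t.
have tc : tau * s @[s --> t] --> tau * t.
  by apply: cvgM; [exact: cvg_cst|exact: cvg_id].
have c1 : cos (tau * s) @[s --> t] --> cos (tau * t).
  exact: (@continuous_comp _ _ _ (fun s => tau * s) cos _ tc (@continuous_cos R _)).
have c2 : sin (tau * s) @[s --> t] --> sin (tau * t).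
  exact: (@continuous_comp _ _ _ (fun s => tau * s) sin _ tc (@continuous_sin R _)).
exact: (cvg_pair c1 c2).
Qed.

Lemma circ_hausdorff : hausdorff_space circ.
Proof.
apply: (@injective_hausdorff _ (R * R)%type (fun z => \val z)).
- exact: norm_hausdorff.
- exact: initial_continuous.
exact: val_inj.
Qed.

(** The lift [L] to [[c, c + 1[] of a continuous map to the circle is continuous
    where it is not equal to [c]: the image of the part of [[c, c + 1]] away
    from the value of [L] is compact. *)
Lemma angle_continuous (c : R) (f : R -> circ) (L : R -> R) t0 :
  {for t0, continuous f} -> (forall t, c <= L t < c + 1) ->
  (forall t, turn (L t) = f t) -> c < L t0 -> {for t0, continuous L}.
Proof.
move=> cf Lc Lf cL; apply/cvgrPdist_lt => e e0.
pose K := turn @` (`[c, c + 1] `&` ~` ball (L t0) e).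
have cK : closed K.
  apply: compact_closed; first exact: circ_hausdorff.
  apply: continuous_compact.
    exact/continuous_subspaceT/turn_continuous.
  apply: (subclosed_compact _ (@segment_compact R c (c + 1))); last exact: subIsetl.
  apply: closedI; first exact: interval_closed.
  by rewrite closedC; exact: ball_open.
have nK : (~` K) (f t0).
  move=> [s [/= sc nb] sf]; have := Lc t0 => /andP[_ Lc1].
  have [n E] : exists n : int, s = L t0 + n%:~R by apply: turn_eq; rewrite Lf.
  move: sc; rewrite in_itv/= => /andP[sc1 sc2].
  apply: nb; suff -> : s = L t0 by exact: ballxx.
  have n0 : n = 0.
    have : ((-1)%:~R : R) < n%:~R by rewrite mulrNz; lra.
    have : (n%:~R : R) < 1%:~R by rewrite mulr1z; lra.
    rewrite !ltr_int => n1 n2; apply/eqP; rewrite eq_le.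
    by rewrite -ltzD1 add0r n1/= -[0%R](addNr 1%R) lezD1.
  by rewrite E n0 addr0.
have : \forall t \near t0, (~` K) (f t).
  by apply: cf; apply: open_nbhs_nbhs; split; [rewrite openC|exact: nK].
apply: filterS => t nKt; apply: contrapT => nb; apply: nKt.
exists (L t); last exact: Lf.
split; last by move=> /= ?; apply: nb.
by rewrite /= in_itv/=; have := Lc t => /andP[-> /ltW ->].
Qed.

(** Restricted to the open unit interval, the lift with values in [[c, c + 1[],
    where [c] is a parameter of the image of the base point, is injective and
    continuous, hence monotone. *)
Lemma circle_lift (f : circ -> circ) : homeomorphism f ->
  exists sg F, lift sg F /\ forall t, turn (F t) = f (turn t).
Proof.
move=> [g [fK gK cf cg]]; pose c := angle (f (turn 0)).
pose L t := c + frac (angle (f (turn t)) - c).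
have Lf t : turn (L t) = f (turn t).
  rewrite /L /frac addrA addrCA subrr addr0 -mulrNz turnDz; exact: angleK.
have Lc t : c <= L t < c + 1 by rewrite /L lerDl ltrD2l; exact: frac01.
have L0 : L 0 = c by rewrite /L subrr frac_id ?addr0// lexx ltr01.
have uniq s t : 0 <= s < 1 -> 0 <= t < 1 -> turn s = turn t -> s = t.
  move=> s01 t01 /turn_eq[n E]; have := fracDz t n.
  by rewrite -E frac_id// frac_id.
have Linj s t : 0 <= s < 1 -> 0 <= t < 1 -> L s = L t -> s = t.
  move=> s01 t01 st; apply: uniq => //; apply: (can_inj fK).
  by rewrite -!Lf st.
have Lgt t : 0 < t < 1 -> c < L t.
  move=> t01; have /andP[+ _] := Lc t; rewrite le_eqVlt => /predU1P[E|//].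
  by have : 0 = t; [apply: Linj; rewrite ?L0//|]; lra.
have Lsurj y : c <= y < c + 1 -> exists2 t, 0 <= t < 1 & L t = y.
  move=> yc; exists (angle (g (turn y))); first exact: angle01.
  have [n E] : exists n : int, L (angle (g (turn y))) = y + n%:~R.
    by apply: turn_eq; rewrite Lf angleK gK.
  have := fracDz (y - c) n; have Lt := Lc (angle (g (turn y))).
  have -> : y - c + n%:~R = L (angle (g (turn y))) - c by rewrite E; ring.
  by rewrite !frac_id; lra.
have cL : {within `]0, 1[, continuous L}.
  apply: continuous_in_subspaceT => t; rewrite inE/= in_itv/= => t01.
  apply: (@angle_continuous c (f \o turn)) => //; last exact: Lgt.
  by apply: continuous_comp; [exact: turn_continuous|exact: cf].
have Linj' : {in `]0, 1[ &, injective L}.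
  by move=> s t; rewrite !in_itv/= => s01 t01; apply: Linj; lra.
have [Linc|Ldec] := itv_continuous_inj_mono cL Linj'.
  have FL : lift 1 (fun t => 1 * (L (frac t) + (Num.floor t)%:~R)).
    apply: (@lift_extend _ _ _ c) => //; first by left.
    move=> s t; rewrite le_eqVlt => /predU1P[<-|s0] st t1.
      by rewrite L0; apply: Lgt; rewrite st.
    by apply: Linc => //; rewrite in_itv/=; lra.
  exists 1, (fun t => 1 * (L (frac t) + (Num.floor t)%:~R)); split => // t.
  by rewrite mul1r turnDz Lf turn_frac.
pose k t := if t == 0 then - (c + 1) else - L t.
have FL : lift (-1) (fun t => -1 * (k (frac t) + (Num.floor t)%:~R)).
  apply: (@lift_extend _ _ _ (- (c + 1))) => //; first by right.
  - move=> s t; rewrite le_eqVlt /k => /predU1P[<-|s0] st t1.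
      by rewrite eqxx gt_eqF//; have := Lc t; lra.
    rewrite !gt_eqF//; last exact: lt_trans st.
    by rewrite ltrN2; apply: Ldec => //; rewrite in_itv/=; lra.
  - move=> t t01; rewrite /k; case: eqP => [_|/eqP t0]; first by lra.
    have : 0 < t < 1 by rewrite lt_neqAle eq_sym t0.
    by move=> /Lgt; have := Lc t; lra.
  move=> y yc; have [yE|yE] := eqVneq y (- (c + 1)).
    by exists 0; rewrite ?lexx ?ltr01// /k eqxx.
  have [|t t01 tE] := Lsurj (- y).
    move: yE yc; rewrite eq_sym => yE /andP[]; rewrite le_eqVlt (negbTE yE)/=; lra.
  exists t => //; rewrite /k; case: eqP => [t0|_]; last by rewrite tE opprK.
  by move: tE; rewrite t0 L0; lra.
exists (-1), (fun t => -1 * (k (frac t) + (Num.floor t)%:~R)); split => // t.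
rewrite mulN1r opprD -mulrNz turnDz /k; case: eqP => [t0|_].
  by rewrite opprK turnD1 -L0 Lf -t0 turn_frac.
by rewrite opprK Lf turn_frac.
Qed.

Theorem circle_blow_up (G : groupType) (rho : G -> circ -> circ) :
  countable [set: G] -> topological_action rho -> subexponential_orbits R rho ->
  exists rho' : G -> circ -> circ, [/\ topological_action rho',
    forall g, circle_C1 (rho' g) & blow_up rho' rho].
Proof.
move=> cG act subexp.
have q01 z : 0 <= angle z <= 1 by have /andP[-> /ltW ->] := angle01 z.
have I01 t : 0 <= t <= 1 -> [set: R] t by [].
have pK t : [set: R] t -> exists2 n : int,
    angle (turn t) = t + n%:~R & forall s, turn (s + n%:~R) = turn s.
  by move=> _; have [n E] := turnK t; exists n => // s; exact: turnDz.
have Ends_p t : 0 < t < 1 -> ~ (set0 : set circ) (turn t) by move=> _ [].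
have frac_p t : [set: R] t -> turn (frac t) = turn t \/
    (set0 : set circ) (turn t) /\ (set0 : set circ) (turn (frac t)).
  by move=> _; left; exact: turn_frac.
have lifts (f : circ -> circ) : homeomorphism f ->
    (exists sg F, lift sg F /\ forall t, [set: R] t ->
       [set: R] (F t) /\ turn (F t) = f (turn t)) /\
    (forall z, (set0 : set circ) (f z) -> (set0 : set circ) z).
  by move=> /circle_lift[sg [F [FL Ff]]]; split => //; exists sg, F.
have [rho' [B [D [act' bu BI BD Dc]]]] := blow_up_of_action circ_hausdorff
  turn_continuous q01 I01 angleK pK Ends_p frac_p
  (or_introl erefl) lifts cG act subexp.
exists rho'; split => // g.
have t0 : tau != 0 by rewrite gt_eqF.
pose F t := tau * B g (t / tau).
have FD t : is_derive t 1 F (D g (t / tau)).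
  have lin : is_derive t 1 (fun s => tau^-1 *: (s : R)) (tau^-1 *: 1).
    exact: (is_deriveZ tau^-1 (is_derive_id t 1)).
  have Bt : is_derive (tau^-1 *: t) 1 (B g) (D g (t / tau)).
    by have := BD g (t / tau); rewrite [t / tau]mulrC.
  have FE : F = fun s => tau *: (B g \o (fun s => tau^-1 *: s)) s.
    by apply/funext => s; rewrite /F [s / tau]mulrC.
  have := is_deriveZ tau (is_derive1_comp Bt lin); rewrite -[_ \*: _]FE.
  by move=> H; apply: (is_derive_eq H); rewrite /GRing.scale/= mulr1 mulrCA divff// mulr1.
have DE : derive1 F = fun t => D g (t / tau).
  by apply/funext => t; rewrite derive1E; have [] := FD t.
have cD : continuous (fun t => D g (t / tau)).
  move=> t; have c : s / tau @[s --> t] --> t / tau.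
    by apply: cvgM; [exact: cvg_id|exact: cvg_cst].
  exact: (@continuous_comp R R R (fun s => s / tau) (D g) t c (Dc g _)).
exists F; split; [by move=> t; have [] := FD t|by rewrite DE|].
move=> t; have [_] := BI g (t / tau) Logic.I.
by rewrite /turn mulrC divfK.
Qed.

End circle.

(** * Conclusion *)

Theorem corollary3p3 (R : realType) (G : groupType)
  (countableG : countable [set: G])
  (M : one_manifold R) (rho : G -> M -> M) :
  topological_action rho ->
  subexponential_orbits R rho ->
  exists rho' : G -> M -> M, C1_action rho' /\ blow_up rho' rho.
Proof.
move=> act subexp.
suff [rho' [act' C1rho' bu]] : exists rho' : G -> M -> M,
    [/\ topological_action rho', forall g, C1 (rho' g) & blow_up rho' rho].
  exists rho'; split => //; split => // g; exists (rho' g^-1%g).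
  have rho1 := action_one act'; have rhoM := action_mul act'.
  by split => // x; rewrite -rhoM ?mulVg ?mulgV rho1.
case: M rho act subexp => [a b ab|] rho act subexp.
  exact: (interval_blow_up ab countableG act subexp).
exact: (circle_blow_up countableG act subexp).
Qed.
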